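(* Let $(M,\omega)$ be a symplectic manifold, $\mathbb A_\hbar(M)$ a deformation quantization with characteristic class $[\theta]$, and $\Gamma\to\mathrm{Symp}(M,\omega)_{[\theta]}$ a group action. This action lifts to an extended action on $\mathbb A_\hbar(M)$ if and only if there exist a Fedosov connection $\nabla_A$ with $\ker\nabla_A\simeq\mathbb A_\hbar(M)$ and sections $c_\gamma\in\mathcal G_1(M)$, $\gamma\in\Gamma$, such that $c_\gamma\circ\gamma^*\nabla_A\circ c_\gamma^{-1}=\nabla_A$ for all $\gamma\in\Gamma$ and such that the $c_\gamma$ form a cocycle, i.e. $$c_\gamma\,\gamma(c_\mu)\,c_{\mu\gamma}^{-1}=\mathrm{Id}\qquad\text{for all }\gamma,\mu\in\Gamma,$$ where $\gamma(c)=\gamma^*\circ c\circ\gamma_*$.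
   Context: Functions, forms and cohomology are complex valued; $\hbar$ is a formal variable; $\dim M=2d$. A formal deformation quantization $\mathbb A_\hbar(M)$ is $C^\infty(M)[[\hbar]]$ with an associative $\mathbb C[[\hbar]]$-bilinear product $f\star g=fg+\sum_{k\ge1}\hbar^kB_k(f,g)$, $B_k$ bidifferential, with $f\star g-g\star f=i\hbar\{f,g\}+\hbar^2C(f,g)$, $C$ bidifferential, and $1\star f=f=f\star1$. Weyl bundle: $\mathcal W\to M$ has fibre $\mathcal W_x$ the completed Weyl algebra generated over $\mathbb C[[\hbar]]$ by $T^*_xM\otimes\mathbb C$ with $vw-wv=i\hbar\,\bar\omega_x(v,w)$ ($\bar\omega$ induced by $\omega$), graded by $|v|=1$, $|\hbar|=2$; $\mathcal W=\mathrm{Sp}_M\times_{\mathrm{Sp}(2d,\mathbb R)}\mathbb W$ with $\mathrm{Sp}_M$ the symplectic frame bundle and $\mathbb W$ the standard Weyl algebra. A Fedosov connection is a flat, $\mathbb C[[\hbar]]$-linear graded-derivation connection on $\Omega^\bullet(M;\mathcal W)$, with $\nabla f=df$ for $f\in C^\infty(M)$, of the form $\nabla_A=[A_{-1},-]+\nabla_0+\sum_{i\ge0}[A_i,-]$ with $\nabla_0$ a symplectic connection, $A_{-1}(X)=\frac{\omega(X,-)}{i\hbar}$, $A_i\in\Omega^1(M;(\frac1{i\hbar}\mathcal W)_i)$. Its kernel $\ker\nabla_A\subset\Gamma(\mathcal W)$ is linearly isomorphic to $C^\infty(M)[[\hbar]]$ and the induced product is a deformation quantization; every deformation quantization is gauge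 equivalent to one of these. The curvature $\Omega_A=\frac{R_0}{i\hbar}+\nabla_0A+\frac12[A,A]$ ($A=\sum_{i\ge-1}A_i$, $\nabla_0^2=[\frac{R_0}{i\hbar},-]$) is closed, central, of the form $\frac{\omega}{i\hbar}+\theta$, and the characteristic class is $[\theta]\in H^2(M)[[\hbar]]$. $\mathrm{Symp}(M,\omega)_{[\theta]}$ is its stabilizer in the symplectomorphism group. $G_1=\{\exp(\frac1{i\hbar}[w,-]):w\in\mathbb W_{\ge3}\}$, a group of automorphisms of $\mathbb W$ normalized by $\mathrm{Sp}(2d,\mathbb R)$; $\mathcal G_1$ is the sheaf of sections of $\mathrm{Sp}_M\times_{\mathrm{Sp}(2d,\mathbb R)}G_1$, acting fibrewise on $\Gamma(\mathcal W)$. Notation: $\gamma^*$ is pull-back by (the symplectomorphism of) $\gamma$, $\gamma_*=(\gamma^{-1})^*$, $\gamma^*\nabla_A=\gamma^*\circ\nabla_A\circ\gamma_*$. An extended action (lift) is a homomorphism $\alpha\colon\Gamma^{op}\to\mathrm{Aut}(\mathbb A_\hbar(M))$ (so $\alpha_\gamma\alpha_\mu=\alpha_{\mu\gamma}$) into $\mathbb C[[\hbar]]$-linear algebra automorphisms with $\alpha_\gamma=c_\gamma\circ\gamma^*$, $c_\gamma\in\mathcal G_1(M)$, such that $c_\gamma\circ\gamma^*\nabla_A\circ c_\gamma^{-1}=\nabla_A$ for some Fedosov connection $\nabla_A$ with $\ker\nabla_A\simeq\mathbb A_\hbar(M)$ (using this identification). *)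

(* Defs.v *)
From HB Require Import structures.
From mathcomp Require Import all_boot all_order all_algebra complex.
From mathcomp Require Import all_classical all_reals all_analysis.
From mathcomp Require Import ring.

Set Implicit Arguments.
Unset Strict Implicit.
Unset Printing Implicit Defensive.

Import Order.TTheory GRing.Theory Num.Theory numFieldNormedType.Exports.

Local Open Scope classical_set_scope.
Local Open Scope ring_scope.
Local Open Scope complex_scope.

Section NearEqDifferentiable.
Variables (R : realType) (V W : normedModType R).

Lemma near_eq_differentiable (f g : V -> W) x :
  (\near x, f x = g x) -> differentiable f x -> differentiable g x.
Proof.
move=> fg df.
have fgx : f x = g x by exact: nbhs_singleton fg.
have cdf : continuous ('d f x) by exact: diff_continuous.
have key : g \o shift x = cst (g x) + 'd f x +o_ (0 : V) id.
  apply/eqaddoP => e e0.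
  have /eqaddoP/(_ e e0) H := diff_locally df.
  have fg0 : \forall y \near (0 : V), f (y + x) = g (y + x).
    by move: fg; rewrite (near_shift 0 x); apply: filterS => y; rewrite /= subr0.
  near=> y.
  have -> : (g \o shift x - (cst (g x) + 'd f x)) y =
            (f \o shift x - (cst (f x) + 'd f x)) y.
    by rewrite !fctE /= fgx; congr (_ - _); apply/esym; near: y.
  by near: y.
have E := diff_unique cdf key.
by apply/diff_locallyP; rewrite E.
Unshelve. all: by end_near. Qed.

End NearEqDifferentiable.

Section SmoothOn.
Variable R : realType.

Fixpoint diff_upto n (k : nat) (U : set 'rV[R]_n) (f : 'rV[R]_n -> R) : Prop :=
  if k is k'.+1 then
    (forall x, U x -> differentiable f x) /\
    (forall v, diff_upto k' U ('D_v f))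
  else True.

Definition smooth_on n (U : set 'rV[R]_n) f := forall k, diff_upto k U f.

Lemma open_near n (U : set 'rV[R]_n) (P : 'rV[R]_n -> Prop) x :
  open U -> U x -> (forall y, U y -> P y) -> \near x, P x.
Proof. by move=> oU Ux UP; apply: filterS UP _; exact: open_nbhs_nbhs. Qed.

Lemma eq_diff_upto n k (U : set 'rV[R]_n) f g : open U ->
  (forall x, U x -> f x = g x) -> diff_upto k U f -> diff_upto k U g.
Proof.
move=> oU; elim: k f g => //= k IH f g fg [df dDf]; split.
  move=> x Ux; apply: near_eq_differentiable (df _ Ux).
  exact: open_near Ux fg.
move=> v; apply: (IH _ _ _ (dDf v)) => x Ux.
by apply: near_eq_derive; exact: open_near Ux fg.
Qed.

Lemma diff_uptoW n k (U : set 'rV[R]_n) f : diff_upto k.+1 U f -> diff_upto k U f.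
Proof. by elim: k f => //= k IH f [df dDf]; split=> // v; exact: IH. Qed.

Lemma diff_uptoS n k (U V : set 'rV[R]_n) f :
  U `<=` V -> diff_upto k V f -> diff_upto k U f.
Proof.
move=> UV; elim: k f => //= k IH f [df dDf]; split=> [x /UV|v]; first exact: df.
exact: IH.
Qed.

Lemma diff_upto_local n k (U : set 'rV[R]_n) f :
  (forall x, U x -> exists2 V, V x & diff_upto k V f) -> diff_upto k U f.
Proof.
elim: k f => //= k IH f H; split=> [x /H[V Vx [df _]]|v]; first exact: df.
by apply: IH => x /H[V Vx [_ dDf]]; exists V.
Qed.

Lemma diff_upto_cst n k (U : set 'rV[R]_n) a : diff_upto k U (cst a).
Proof.
elim: k a => //= k IH a; split=> [x _|v]; first exact: differentiable_cst.
by rewrite (_ : 'D_v _ = cst 0) //; apply/funext => x; exact: derive_cst.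
Qed.

Lemma diff_uptoD n k (U : set 'rV[R]_n) f g : open U ->
  diff_upto k U f -> diff_upto k U g -> diff_upto k U (f \+ g).
Proof.
move=> oU; elim: k f g => //= k IH f g [df dDf] [dg dDg]; split=> [x Ux|v].
  by apply: differentiableD; [exact: df|exact: dg].
apply: eq_diff_upto (IH _ _ (dDf v) (dDg v)) => // x Ux /=.
by rewrite deriveD //; apply: diff_derivable; [exact: df|exact: dg].
Qed.

Lemma diff_uptoM n k (U : set 'rV[R]_n) f g : open U ->
  diff_upto k U f -> diff_upto k U g -> diff_upto k U (f \* g).
Proof.
move=> oU; elim: k f g => // k IH f g Hf Hg.
have [df dDf] := Hf; have [dg dDg] := Hg; split=> [x Ux|v].
  by apply: differentiableM; [exact: df|exact: dg].
have H := diff_uptoD oU (IH _ _ (diff_uptoW Hf) (dDg v))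
                        (IH _ _ (diff_uptoW Hg) (dDf v)).
apply: eq_diff_upto H => // x Ux /=.
by rewrite deriveM //; apply: diff_derivable; [exact: df|exact: dg].
Qed.

Lemma diff_uptoN n k (U : set 'rV[R]_n) f : open U ->
  diff_upto k U f -> diff_upto k U (\- f).
Proof.
move=> oU Hf; apply: eq_diff_upto (diff_uptoM oU (diff_upto_cst k U (-1)) Hf) => //.
by move=> x _ /=; rewrite mulN1r.
Qed.

Lemma diff_upto_sum n k (U : set 'rV[R]_n) m (F : 'I_m -> 'rV[R]_n -> R) : open U ->
  (forall i, diff_upto k U (F i)) -> diff_upto k U (fun x => \sum_i F i x).
Proof.
move=> oU HF.
have : forall s : seq 'I_m, diff_upto k U (fun x => \sum_(i <- s) F i x).
  elim=> [|i s IH].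
    by apply: eq_diff_upto (diff_upto_cst k U 0) => // x _; rewrite big_nil.
  apply: eq_diff_upto (diff_uptoD oU (HF i) IH) => // x _ /=.
  by rewrite big_cons.
exact.
Qed.

Lemma differentiable_rowP m n (g : 'rV[R]_m -> 'rV[R]_n) x :
  (forall j, differentiable (fun y => g y ord0 j) x) -> differentiable g x.
Proof.
move=> dg.
have -> : g = \sum_j (fun y => g y ord0 j *: delta_mx ord0 j).
  by apply/funext => y; rewrite fct_sumE; exact: row_sum_delta.
apply: differentiable_sum => j; exact: differentiableZl.
Qed.

Lemma diff_upto_comp m n k (U : set 'rV[R]_m) (V : set 'rV[R]_n) f
    (g : 'rV[R]_m -> 'rV[R]_n) : open U ->
  (forall x, U x -> V (g x)) ->
  diff_upto k V f -> (forall j, diff_upto k U (fun y => g y ord0 j)) ->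
  diff_upto k U (f \o g).
Proof.
move=> oU UV; elim: k f => // k IH f [df dDf] dg.
have dgx x : U x -> differentiable g x.
  by move=> Ux; apply: differentiable_rowP => j; exact: (dg j).1.
split=> [x Ux|v].
  by apply: differentiable_comp; [exact: dgx|apply: df; exact: UV].
have H j : diff_upto k U (('D_(delta_mx ord0 j) f \o g) \*
                          'D_v (fun y => g y ord0 j)).
  apply: diff_uptoM => //; last exact: (dg j).2.
  by apply: (IH _ (dDf _)) => i; apply: diff_uptoW; exact: dg.
apply: eq_diff_upto (diff_upto_sum oU H) => // x Ux /=.
have dfg : differentiable f (g x) by apply: df; exact: UV.
rewrite [RHS]deriveE; last by apply: differentiable_comp => //; exact: dgx.
rewrite diff_comp //; last exact: dgx.
rewrite /= (row_sum_delta ('d g x v)) linear_sum; apply: eq_bigr => j _.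
have dgv : derivable g x v by apply: diff_derivable; exact: dgx.
rewrite linearZ /= -deriveE; last exact: dgx.
rewrite -deriveE // derive_mx // mxE.
by rewrite -[RHS]/(_ * _) [RHS]mulrC.
Qed.

End SmoothOn.

Record chart (R : realType) (n : nat) (T : topologicalType) := Chart {
  chart_dom : set T;
  chart_map : T -> 'rV[R]_n;
  chart_inv : 'rV[R]_n -> T;
  chart_dom_open : open chart_dom;
  chart_codom_open : open (chart_map @` chart_dom);
  chart_mapK : forall x, chart_dom x -> chart_inv (chart_map x) = x;
  chart_map_cts : forall x, chart_dom x -> {for x, continuous chart_map};
  chart_inv_cts :
    forall u, (chart_map @` chart_dom) u -> {for u, continuous chart_inv} }.

Record manifold (R : realType) (n : nat) := Manifold {
  manifold_space :> topologicalType;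
  manifold_hausdorff : hausdorff_space manifold_space;
  manifold_second_countable : @second_countable manifold_space;
  atlas : set (chart R n manifold_space);
  atlas_cover : forall x, exists2 c, atlas c & chart_dom c x;
  atlas_compat : forall c c', atlas c -> atlas c' ->
    forall j, smooth_on (chart_map c @` (chart_dom c `&` chart_dom c'))
                (fun u => chart_map c' (chart_inv c u) ord0 j) }.

Section SmoothFunctions.
Variables (R : realType) (n : nat) (M : manifold R n).

Definition smooth_real (f : M -> R) := forall c, atlas c ->
  smooth_on (chart_map c @` chart_dom c) (f \o chart_inv c).

Definition smooth_fun (f : M -> R[i]) :=
  smooth_real (fun x => complex.Re (f x)) /\ smooth_real (fun x => complex.Im (f x)).

Definition smooth_map (g : M -> M) := continuous g /\
  forall c c', atlas c -> atlas c' ->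
  forall j, smooth_on (chart_map c @` (chart_dom c `&` g @^-1` chart_dom c'))
              (fun u => chart_map c' (g (chart_inv c u)) ord0 j).

Lemma chart_image_open (c : chart R n M) (V : set M) : open V ->
  open (chart_map c @` (chart_dom c `&` V)).
Proof.
move=> oV; rewrite openE => _ [x [cx Vx] <-]; rewrite /interior.
have cu : (chart_map c @` chart_dom c) (chart_map c x) by exists x.
have N1 : nbhs (chart_map c x) (chart_map c @` chart_dom c).
  by apply: open_nbhs_nbhs; split=> //; exact: chart_codom_open.
have N2 : nbhs (chart_map c x) (chart_inv c @^-1` V).
  apply: (chart_inv_cts cu); rewrite chart_mapK //.
  by apply: open_nbhs_nbhs.
apply: filterS (filterI N1 N2) => u [[y cy <-]] /=.
by rewrite chart_mapK // => Vy; exists y.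
Qed.

Lemma smooth_real_comp (f : M -> R) (g : M -> M) :
  smooth_real f -> smooth_map g -> smooth_real (f \o g).
Proof.
move=> sf [cg sg] c Ac k; apply: diff_upto_local => _ [x cx <-].
have [c' Ac' c'gx] := atlas_cover (g x).
set V := chart_dom c `&` g @^-1` chart_dom c'.
have oV : open (chart_map c @` V).
  apply: chart_image_open; apply: open_comp; last exact: chart_dom_open.
  by move=> y _; exact: cg.
exists (chart_map c @` V); first by exists x.
have H := diff_upto_comp oV _ (sf c' Ac' k) (fun j => sg c c' Ac Ac' j k).
apply: eq_diff_upto (H _) => //.
  move=> _ [y [cy /= c'gy] <-] /=.
  by rewrite !chart_mapK.
by move=> _ [y [cy c'gy] <-]; rewrite chart_mapK //; exists (g y).
Qed.

Lemma smooth_fun_comp (f : M -> R[i]) (g : M -> M) :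
  smooth_fun f -> smooth_map g -> smooth_fun (f \o g).
Proof.
by move=> [rf imf] sg; split; [apply: smooth_real_comp rf sg|
                              apply: smooth_real_comp imf sg].
Qed.

Lemma smooth_real_cst a : smooth_real (cst a).
Proof. by move=> c _ k; exact: diff_upto_cst. Qed.

Lemma smooth_realD f g :
  smooth_real f -> smooth_real g -> smooth_real (fun x => f x + g x).
Proof.
by move=> sf sg c Ac k; exact: diff_uptoD (@chart_codom_open _ _ _ c)
  (sf c Ac k) (sg c Ac k).
Qed.

Lemma smooth_realN f : smooth_real f -> smooth_real (fun x => - f x).
Proof.
by move=> sf c Ac k; exact: diff_uptoN (@chart_codom_open _ _ _ c) (sf c Ac k).
Qed.

Lemma smooth_realM f g :
  smooth_real f -> smooth_real g -> smooth_real (fun x => f x * g x).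
Proof.
by move=> sf sg c Ac k; exact: diff_uptoM (@chart_codom_open _ _ _ c)
  (sf c Ac k) (sg c Ac k).
Qed.

Lemma smooth_fun_cst a : smooth_fun (cst a).
Proof. by split; exact: smooth_real_cst. Qed.

Lemma smooth_funB f g :
  smooth_fun f -> smooth_fun g -> smooth_fun (fun x => f x - g x).
Proof.
move=> [rf imf] [rg img]; split.
  rewrite (_ : (fun x => _) = fun x => complex.Re (f x) + - complex.Re (g x)).
    by apply: smooth_realD => //; exact: smooth_realN.
  by apply/funext => x; case: (f x) (g x) => ? ? [].
rewrite (_ : (fun x => _) = fun x => complex.Im (f x) + - complex.Im (g x)).
  by apply: smooth_realD => //; exact: smooth_realN.
by apply/funext => x; case: (f x) (g x) => ? ? [].
Qed.

Lemma smooth_funM f g :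
  smooth_fun f -> smooth_fun g -> smooth_fun (fun x => f x * g x).
Proof.
move=> [rf imf] [rg img]; split.
  rewrite (_ : (fun x => _) =
      fun x => complex.Re (f x) * complex.Re (g x) + - (complex.Im (f x) * complex.Im (g x))).
    by apply: smooth_realD; [|apply: smooth_realN]; exact: smooth_realM.
  by apply/funext => x; case: (f x) (g x) => ? ? [].
rewrite (_ : (fun x => _) =
    fun x => complex.Re (f x) * complex.Im (g x) + complex.Im (f x) * complex.Re (g x)).
  by apply: smooth_realD; exact: smooth_realM.
by apply/funext => x; case: (f x) (g x) => ? ? [].
Qed.

Lemma smooth_fun_conj f : smooth_fun f -> smooth_fun (fun x => (f x)^*).
Proof.
move=> [rf imf]; split.
  rewrite (_ : (fun x => _) = fun x => complex.Re (f x)) //.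
  by apply/funext => x; case: (f x).
rewrite (_ : (fun x => _) = fun x => - complex.Im (f x)); first exact: smooth_realN.
by apply/funext => x; case: (f x).
Qed.

Definition smooth_pred : {pred M -> R[i]} := fun f => `[< smooth_fun f >].

Lemma smooth_subring_closed : subring_closed smooth_pred.
Proof.
split=> [|f g /asboolP sf /asboolP sg|f g /asboolP sf /asboolP sg];
  apply/asboolP.
- exact: smooth_fun_cst.
- exact: smooth_funB.
- exact: smooth_funM.
Qed.

Record Cinfty := MkCinfty { Cinfty_val :> M -> R[i]; _ : Cinfty_val \in smooth_pred }.

HB.instance Definition _ := [isSub for Cinfty_val].
HB.instance Definition _ := [Choice of Cinfty by <:].
HB.instance Definition _ := 
  GRing.SubChoice_isSubComPzRing.Build _ _ Cinfty smooth_subring_closed.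

Lemma CinftyP (f : Cinfty) : smooth_fun f.
Proof. by apply/asboolP; case: f. Qed.

Definition mkC (f : M -> R[i]) (sf : smooth_fun f) : Cinfty :=
  MkCinfty (introT (asboolP _) sf).

Definition cstC (a : R[i]) : Cinfty := mkC (smooth_fun_cst a).

Lemma Cinfty_inj (f g : Cinfty) : f =1 g -> f = g.
Proof. by move=> fg; apply/val_inj/funext. Qed.

Definition Cscale (a : R[i]) (f : Cinfty) : Cinfty := cstC a * f.

Lemma CscaleA a b f : Cscale a (Cscale b f) = Cscale (a * b) f.
Proof. by apply: Cinfty_inj => x; exact: mulrA. Qed.
Lemma Cscale1 : left_id 1 Cscale.
Proof. by move=> f; apply: Cinfty_inj => x; exact: mul1r. Qed.
Lemma CscaleDr : right_distributive Cscale +%R.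
Proof. by move=> a f g; exact: mulrDr. Qed.
Lemma CscaleDl f : {morph Cscale^~ f : a b / a + b}.
Proof. by move=> a b; apply: Cinfty_inj => x; exact: mulrDl. Qed.

HB.instance Definition _ := GRing.Zmodule_isLmodule.Build R[i] Cinfty
  CscaleA Cscale1 CscaleDr CscaleDl.

Definition Cconj (f : Cinfty) : Cinfty := mkC (smooth_fun_conj (CinftyP f)).

End SmoothFunctions.

Section Tangent.
Variables (R : realType) (n : nat) (M : manifold R n).
Local Notation F := (Cinfty M).

(* The complexified tangent space T_xM (x) C: C-linear point derivations. *)
Definition tangent_pred (x : M) : {pred F -> R[i]^o} := fun v =>
  `[< (forall a f g, v (a *: f + g) = a * v f + v g) /\
      (forall f g, v (f * g) = v f * g x + f x * v g) >].

Lemma tangent_submod_closed x : submod_closed (tangent_pred x).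
Proof.
split=> [|a u v /asboolP[ul ud] /asboolP[vl vd]]; apply/asboolP; split.
- by move=> b f g; rewrite -[LHS]/(0 : R[i]) -[RHS]/(b * 0 + 0) mulr0 addr0.
- by move=> f g; rewrite -[LHS]/(0 : R[i]) -[RHS]/(0 * g x + f x * 0); ring.
- move=> b f g; rewrite -[LHS]/(a * u (b *: f + g) + v (b *: f + g)) ul vl.
  by rewrite -[RHS]/(b * (a * u f + v f) + (a * u g + v g)); ring.
- move=> f g; rewrite -[LHS]/(a * u (f * g) + v (f * g)) ud vd.
  by rewrite -[RHS]/((a * u f + v f) * g x + f x * (a * u g + v g)); ring.
Qed.

Record tangent (x : M) := MkTangent {
  tangent_val :> F -> R[i]^o; _ : tangent_val \in tangent_pred x }.

Section TangentInstances.
Variable x : M.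
HB.instance Definition _ := [isSub for @tangent_val x].
HB.instance Definition _ := [Choice of tangent x by <:].
HB.instance Definition _ :=
  GRing.SubChoice_isSubLmodule.Build _ _ _ (tangent x) (tangent_submod_closed x).
End TangentInstances.

(* Complex vector fields on M, as derivations of C^oo(M). *)
Definition vfield_pred : {pred F -> F^o} := fun X =>
  `[< (forall (a : R[i]) f g, X (a *: f + g) = a *: (X f : F) + X g) /\
      (forall f g, X (f * g) = X f * g + f * X g) >].

Lemma vfield_submod_closed : submod_closed vfield_pred.
Proof.
split=> [|h X Y /asboolP[Xl Xd] /asboolP[Yl Yd]]; apply/asboolP; split.
- by move=> b f g; rewrite -[LHS]/(0 : F) -[RHS]/(b *: (0 : F) + 0) scaler0 addr0.
- by move=> f g; rewrite -[LHS]/(0 : F) -[RHS]/(0 * g + f * 0) mul0r mulr0 addr0.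
- move=> b f g; rewrite -[LHS]/(h * X (b *: f + g) + Y (b *: f + g)) Xl Yl.
  rewrite -[RHS]/(cstC M b * (h * X f + Y f) + (h * X g + Y g)).
  rewrite -[b *: (X f : F)]/(cstC M b * X f) -[b *: (Y f : F)]/(cstC M b * Y f).
  by rewrite !mulrDr mulrCA -!addrA; congr (_ + _); rewrite addrCA.
- move=> f g; rewrite -[LHS]/(h * X (f * g) + Y (f * g)) Xd Yd.
  rewrite -[RHS]/((h * X f + Y f) * g + f * (h * X g + Y g)).
  by rewrite !mulrDr mulrDl mulrA (mulrCA f h) -!addrA; congr (_ + _); rewrite addrCA.
Qed.

Record vfield := MkVfield { vfield_val :> F -> F^o; _ : vfield_val \in vfield_pred }.
HB.instance Definition _ := [isSub for vfield_val].
HB.instance Definition _ := [Choice of vfield by <:].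
HB.instance Definition _ :=
  GRing.SubChoice_isSubLmodule.Build _ _ _ vfield vfield_submod_closed.

End Tangent.
Section VectorFields.
Variables (R : realType) (n : nat) (M : manifold R n).
Local Notation F := (Cinfty M).
Implicit Types (f g : F) (X Y : vfield M).

Lemma tangentZD x (v : tangent x) a f g : v (a *: f + g) = a * v f + v g.
Proof. by case: v => v /= /asboolP[]. Qed.

Lemma tangentM x (v : tangent x) f g : v (f * g) = v f * g x + f x * v g.
Proof. by case: v => v /= /asboolP[]. Qed.

Definition mk_tangent x (v : F -> R[i]^o)
  (vl : forall a f g, v (a *: f + g) = a * v f + v g)
  (vd : forall f g, v (f * g) = v f * g x + f x * v g) : tangent x :=
  MkTangent (introT (asboolP _) (conj vl vd)).

Lemma vfieldZD X (a : R[i]) f g : X (a *: f + g) = a *: (X f : F) + X g.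
Proof. by case: X => X /= /asboolP[]. Qed.

Lemma vfieldM X f g : X (f * g) = X f * g + f * X g.
Proof. by case: X => X /= /asboolP[]. Qed.

Definition mk_vfield (X : F -> F)
  (Xl : forall (a : R[i]) f g, X (a *: f + g) = a *: X f + X g)
  (Xd : forall f g, X (f * g) = X f * g + f * X g) : vfield M :=
  @MkVfield _ _ M X (introT (asboolP _) (conj Xl Xd)).

Section At.
Variables (x : M) (X : vfield M).

Lemma vf_atZD a f g : (X (a *: f + g) : F) x = a * (X f : F) x + (X g : F) x.
Proof. by rewrite vfieldZD. Qed.
Lemma vf_atM f g : (X (f * g) : F) x = (X f : F) x * g x + f x * (X g : F) x.
Proof. by rewrite vfieldM. Qed.

Definition vf_at : tangent x :=
  @mk_tangent x (fun f => (X f : F) x) vf_atZD vf_atM.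
End At.

Section Bracket.
Variables X Y : vfield M.
Let br f : F := X (Y f) - Y (X f).

Lemma vf_bracketZD (a : R[i]) f g : br (a *: f + g) = a *: br f + br g.
Proof.
by rewrite /br !vfieldZD scalerBr opprD -!addrA; congr (_ + _); rewrite addrCA.
Qed.
Lemma vf_bracketM f g : br (f * g) = br f * g + f * br g.
Proof.
rewrite /br !vfieldM.
have XD : forall u v, X (u + v) = X u + X v :> F.
  by move=> u v; rewrite -[u in LHS]scale1r vfieldZD scale1r.
have YD : forall u v, Y (u + v) = Y u + Y v :> F.
  by move=> u v; rewrite -[u in LHS]scale1r vfieldZD scale1r.
rewrite XD YD !vfieldM; apply: Cinfty_inj => x.
pose ev h : R[i] := (h : F) x.
rewrite -[LHS]/(ev (X (Y f)) * ev g + ev (Y f) * ev (X g) +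
    (ev (X f) * ev (Y g) + ev f * ev (X (Y g))) -
  (ev (Y (X f)) * ev g + ev (X f) * ev (Y g) +
    (ev (Y f) * ev (X g) + ev f * ev (Y (X g))))).
rewrite -[RHS]/((ev (X (Y f)) - ev (Y (X f))) * ev g +
  ev f * (ev (X (Y g)) - ev (Y (X g)))).
by ring.
Qed.

Definition vf_bracket : vfield M := mk_vfield vf_bracketZD vf_bracketM.
End Bracket.

Definition tangent_real x (v : tangent x) :=
  forall f, v (Cconj f) = (v f)^*.

Definition vfield_real X := forall f, X (Cconj f) = Cconj (X f : F).

End VectorFields.
Section Diffeomorphisms.
Variables (R : realType) (n : nat) (M : manifold R n).
Local Notation F := (Cinfty M).

Record diffeo := Diffeo {
  dmap :> M -> M;
  dmap_inv : M -> M;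
  dmapK : cancel dmap dmap_inv;
  dmap_invK : cancel dmap_inv dmap;
  dmap_smooth : smooth_map dmap;
  dmap_inv_smooth : smooth_map dmap_inv }.

Definition dinv (g : diffeo) : diffeo :=
  Diffeo (dmap_invK g) (dmapK g) (dmap_inv_smooth g) (dmap_smooth g).

Variable g : diffeo.

Definition Cpull (f : F) : F := mkC (smooth_fun_comp (CinftyP f) (dmap_smooth g)).

Section PushTangent.
Variables (x : M) (v : tangent x).
Lemma dpushZD a (f h : F) :
  v (Cpull (a *: f + h)) = a * v (Cpull f) + v (Cpull h).
Proof.
rewrite -tangentZD; congr (tangent_val v _); exact: Cinfty_inj.
Qed.
Lemma dpushM (f h : F) :
  v (Cpull (f * h)) = v (Cpull f) * h (g x) + f (g x) * v (Cpull h).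
Proof.
rewrite (_ : Cpull (f * h) = Cpull f * Cpull h); first exact: tangentM.
exact: Cinfty_inj.
Qed.

Definition dpush : tangent (g x) := mk_tangent dpushZD dpushM.
End PushTangent.

End Diffeomorphisms.

Section PushVectorFields.
Variables (R : realType) (n : nat) (M : manifold R n) (g : diffeo M).
Variable X : vfield M.
Local Notation F := (Cinfty M).
Let push (f : F) : F := Cpull (dinv g) (X (Cpull g f)).

Lemma vpushZD (a : R[i]) (f h : F) : push (a *: f + h) = a *: push f + push h.
Proof.
rewrite /push (_ : Cpull g _ = a *: Cpull g f + Cpull g h); last exact: Cinfty_inj.
by rewrite vfieldZD; exact: Cinfty_inj.
Qed.
Lemma vpushM (f h : F) : push (f * h) = push f * h + f * push h.
Proof.
rewrite /push (_ : Cpull g _ = Cpull g f * Cpull g h); last exact: Cinfty_inj.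
rewrite vfieldM; apply: Cinfty_inj => x.
set y := dmap_inv g x.
rewrite -[LHS]/((X (Cpull g f) : F) y * h (g y) + f (g y) * (X (Cpull g h) : F) y).
by rewrite /y dmap_invK.
Qed.

Definition vpush : vfield M := mk_vfield vpushZD vpushM.

Lemma dpush_vf_at x : dpush g (vf_at x X) = vf_at (g x) vpush.
Proof.
apply/val_inj/funext => f /=.
by rewrite /push /= dmapK.
Qed.
End PushVectorFields.

Section Forms.
Variables (R : realType) (n : nat) (M : manifold R n).
Local Notation F := (Cinfty M).

Record form1 := Form1 {
  form1_val :> forall x : M, tangent x -> R[i];
  form1_lin : forall x a (u v : tangent x),
    form1_val (a *: u + v) = a * form1_val u + form1_val v;
  form1_smooth : forall X : vfield M, smooth_fun (fun x => form1_val (vf_at x X)) }.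

Record form2 := Form2 {
  form2_val :> forall x : M, tangent x -> tangent x -> R[i];
  form2_lin : forall x a (u v w : tangent x),
    form2_val (a *: u + v) w = a * form2_val u w + form2_val v w;
  form2_anti : forall x (u v : tangent x), form2_val u v = - form2_val v u;
  form2_smooth : forall X Y : vfield M,
    smooth_fun (fun x => form2_val (vf_at x X) (vf_at x Y)) }.

Definition ev1 (b : form1) (X : vfield M) : F := mkC (form1_smooth b X).
Definition ev2 (e : form2) (X Y : vfield M) : F := mkC (form2_smooth e X Y).

Definition closed2 (e : form2) := forall X Y Z : vfield M,
  X (ev2 e Y Z) + Y (ev2 e Z X) + Z (ev2 e X Y)
  - ev2 e (vf_bracket X Y) Z - ev2 e (vf_bracket Y Z) X
  - ev2 e (vf_bracket Z X) Y = 0 :> F.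

Definition cohomologous (e e' : form2) := exists b : form1,
  forall X Y : vfield M,
    ev2 e X Y - ev2 e' X Y
    = X (ev1 b Y) - Y (ev1 b X) - ev1 b (vf_bracket X Y) :> F.

End Forms.

Section FormPullback.
Variables (R : realType) (n : nat) (M : manifold R n) (g : diffeo M) (e : form2 M).
Let pb (x : M) (u v : tangent x) := e (g x) (dpush g u) (dpush g v).

Lemma form2_pull_lin x a (u v w : tangent x) :
  pb (a *: u + v) w = a * pb u w + pb v w.
Proof.
rewrite /pb -form2_lin; congr (e _ _ _).
exact/val_inj/funext.
Qed.
Lemma form2_pull_anti x (u v : tangent x) : pb u v = - pb v u.
Proof. exact: form2_anti. Qed.
Lemma form2_pull_smooth (X Y : vfield M) :
  smooth_fun (fun x => pb (vf_at x X) (vf_at x Y)).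
Proof.
rewrite (_ : (fun x => _) = ev2 e (vpush g X) (vpush g Y) \o g).
  by apply: smooth_fun_comp; [exact: CinftyP|exact: dmap_smooth].
by apply/funext => x; rewrite /pb !dpush_vf_at.
Qed.

Definition form2_pull : form2 M :=
  Form2 form2_pull_lin form2_pull_anti form2_pull_smooth.
End FormPullback.

Section SymplecticForms.
Variables (R : realType) (n : nat) (M : manifold R n).

Record symplectic_form := SymplecticForm {
  sform :> form2 M;
  sform_real : forall x (u v : tangent x),
    tangent_real u -> tangent_real v -> sform x u v \is Num.real;
  sform_closed : closed2 sform;
  sform_nondeg : forall x (u : tangent x), (forall v, sform x u v = 0) -> u = 0 }.

Definition symplecto (omega : symplectic_form) (g : diffeo M) :=
  forall x (u v : tangent x), omega (g x) (dpush g u) (dpush g v) = omega x u v.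

(* Torsion-free connections on TM (extended complex-linearly to TM (x) C) for *)
(* which omega is parallel.                                                   *)
Record symplectic_connection (omega : symplectic_form) := SymplecticConnection {
  scon :> vfield M -> vfield M -> vfield M;
  scon_linl : forall (f : Cinfty M) (X Y Z : vfield M),
    scon (f *: X + Y) Z = f *: scon X Z + scon Y Z;
  scon_addr : forall X Y Z : vfield M, scon X (Y + Z) = scon X Y + scon X Z;
  scon_leibniz : forall (X : vfield M) (f : Cinfty M) (Y : vfield M),
    scon X (f *: Y) = (X f : Cinfty M) *: Y + f *: scon X Y;
  scon_real : forall X Y, vfield_real X -> vfield_real Y -> vfield_real (scon X Y);
  scon_torsionfree : forall X Y : vfield M, scon X Y - scon Y X = vf_bracket X Y;
  scon_parallel : forall X Y Z : vfield M,
    X (ev2 omega Y Z) = ev2 omega (scon X Y) Z + ev2 omega Y (scon X Z) }.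

End SymplecticForms.
(* An element a of the fibre W_x is stored as a family of symmetric           *)
(* multilinear forms: a l [:: y_1; ...; y_k] is the coefficient of hbar^l in  *)
(* the k-th derivative at 0, in the directions y_1, ..., y_k, of the          *)
(* (C[[hbar]]-valued, formal) function a on T_xM.  So v in T_x^*M (x) C sits  *)
(* in l = 0, k = 1, and the (l, k) component has degree 2 l + k.  No bound is *)
(* put on l and k: this is the completed algebra.                             *)

Section WeylSections.
Variables (R : realType) (n : nat) (M : manifold R n).

Definition weyl (x : M) := nat -> seq (tangent x) -> R[i].

Definition weyl_multilinear x (a : weyl x) := forall l,
  (forall ys zs, perm_eq ys zs -> a l ys = a l zs) /\
  (forall k (u v : tangent x) ys,
     a l (k *: u + v :: ys) = k * a l (u :: ys) + a l (v :: ys)).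

Definition weyl_ge (m : nat) x (a : weyl x) :=
  forall l ys, (l.*2 + size ys < m)%N -> a l ys = 0.

Record wsection := WSection {
  wval :> forall x, weyl x;
  wval_multilinear : forall x, weyl_multilinear (@wval x);
  wval_smooth : forall l (Ys : seq (vfield M)),
    smooth_fun (fun x => @wval x l (map (vf_at x) Ys)) }.

Definition wcoef (s : wsection) l Ys : Cinfty M := mkC (wval_smooth s l Ys).

End WeylSections.

Section WeylPullback.
Variables (R : realType) (n : nat) (M : manifold R n) (g : diffeo M).
Variable s : wsection M.
Let pb x : weyl x := fun l ys => s (g x) l (map (dpush g (x := x)) ys).

Lemma wpull_multilinear x : weyl_multilinear (@pb x).
Proof.
move=> l; have [sym lin] := wval_multilinear s (g x) l; split.
  by move=> ys zs yz; apply: sym; exact: perm_map.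
move=> k u v ys; rewrite /pb /= -lin; congr (s _ _ (_ :: _)).
exact/val_inj/funext.
Qed.
Lemma wpull_smooth l (Ys : seq (vfield M)) :
  smooth_fun (fun x => @pb x l (map (vf_at x) Ys)).
Proof.
rewrite (_ : (fun x => _) = wcoef s l (map (vpush g) Ys) \o g).
  by apply: smooth_fun_comp; [exact: CinftyP|exact: dmap_smooth].
apply/funext => x; rewrite /pb /= -!map_comp; congr (s _ _ _).
by apply: eq_map => X /=; exact: dpush_vf_at.
Qed.

Definition wpull : wsection M := WSection wpull_multilinear wpull_smooth.
End WeylPullback.

Section WeylProduct.
Variables (R : realType) (d : nat) (M : manifold R (d + d)).
Variable omega : symplectic_form M.

Definition stdJ : 'M[R[i]]_(d + d) := block_mx 0 1%:M (- 1%:M) 0.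

Definition is_sframe x (e : 'I_(d + d) -> tangent x) :=
  (forall i j, omega x (e i) (e j) = stdJ i j) /\
  (forall v, exists c : 'I_(d + d) -> R[i], v = \sum_i c i *: e i).

(* Every T_xM has a symplectic basis; the operations below do not depend on   *)
(* the one that is chosen.                                                    *)
Definition sframe (x : M) : 'I_(d + d) -> tangent x :=
  xget (fun=> 0) [set e | is_sframe e].

(* Contraction with the bivector omega-bar. As J J J^T = J, its matrix in a   *)
(* symplectic basis is J, and omega-bar(i_u omega, i_v omega) = omega(u, v).  *)
Definition wcontr x (h : seq (tangent x) -> seq (tangent x) -> R[i]) ys zs :=
  \sum_i \sum_j stdJ i j * h (sframe x i :: ys) (sframe x j :: zs).

Definition poisson (f g : Cinfty M) (x : M) : R[i] :=
  \sum_i \sum_j stdJ i j * (sframe x i f * sframe x j g).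

(* The Moyal-Weyl product: mult o exp (i hbar/2 omega-bar), where the product *)
(* of two functions is differentiated by the Leibniz rule, i.e. by summing    *)
(* over the ways to distribute the y's.                                       *)
Definition wmul x (a b : weyl x) : weyl x := fun l ys =>
  \sum_(r < l.+1) \sum_(p < (l - r).+1)
    ('i / 2) ^+ r / r`!%:R *
    \sum_(m : (size ys).-tuple bool)
      iter r (@wcontr x) (fun us vs => a p us * b (l - r - p)%N vs)
        (mask m ys) (mask (map negb m) ys).

Lemma stdJ_anti i j : stdJ i j = - stdJ j i.
Proof.
suff: stdJ = - (stdJ)^T by move=> E; rewrite {1}E !mxE.
rewrite /stdJ tr_block_mx !trmx0 linearN /= !trmx1 opp_block_mx.
by rewrite !oppr0 opprK.
Qed.

(* covector v is v as an element of W_x. The product satisfies the defining   *)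
(* relation v w - w v = i hbar omega-bar(v, w).                               *)
Definition covector (x : M) (v : tangent x -> R[i]) : weyl x := fun l ys =>
  match l, ys with 0%N, [:: y] => v y | _, _ => 0 end.

Lemma covector_commutator (x : M) (v w : tangent x -> R[i]) :
  wmul (covector v) (covector w) 1 [::]
  - wmul (covector w) (covector v) 1 [::]
  = 'i * \sum_i \sum_j
      stdJ i j * (v (sframe x i) * w (sframe x j)).
Proof.
have E : forall v w : tangent x -> R[i], wmul (covector v) (covector w) 1 [::] =
   'i / 2 * \sum_i \sum_j
      stdJ i j * (v (sframe x i) * w (sframe x j)).
  move=> {}v {}w; rewrite /wmul !big_ord_recl big_ord0 !addr0 /=.
  rewrite [X in _ * X + _]big1; last by move=> m _; rewrite mulr0.
  rewrite [X in _ + _ * X + _]big1; last by move=> m _; rewrite mul0r.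
  rewrite !mulr0 !add0r expr1 divr1 (_ : (1 - bump 0 0)%N = 0%N) // !big_ord0 ?addr0.
  congr (_ * _).
  by rewrite (big_pred1 [tuple]) ?mask0 // => m; rewrite (tuple0 m); apply/esym/eqP; exact: val_inj.
rewrite !E; set S1 := \sum_i _; set S2 := \sum_i _.
have -> : S2 = - S1.
  rewrite /S1 /S2 exchange_big /= -sumrN; apply: eq_bigr => i _.
  rewrite -sumrN; apply: eq_bigr => j _.
  by rewrite (stdJ_anti j i) mulNr (mulrC (w _)).
by field.
Qed.
(* (1 / (i hbar)) [a, b]; the commutator has no hbar^0 term. *)
Definition wad x (a b : weyl x) : weyl x := fun l ys =>
  (wmul a b l.+1 ys - wmul b a l.+1 ys) / 'i.

(* exp ((1 / (i hbar)) [w, -]) for w of degree >= 3: the bracket then raises  *)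
(* the degree, so only the first terms contribute to a given component.       *)
Definition wexp x (w a : weyl x) : weyl x := fun l ys =>
  \sum_(k < (l.*2 + size ys).+1) (k`!%:R)^-1 * iter k (wad w) a l ys.

(* Sections of the bundle of groups with fibre G_1, through their action on   *)
(* Gamma(W).                                                                  *)
Record G1_section := G1Section {
  g1 :> wsection M -> wsection M;
  g1_inv : wsection M -> wsection M;
  g1K : cancel g1 g1_inv;
  g1_invK : cancel g1_inv g1;
  g1_exp : exists2 w : wsection M, (forall x, weyl_ge 3 (w x)) &
    forall (s : wsection M) x l ys, g1 s x l ys = wexp (w x) (s x) l ys }.

End WeylProduct.
Section Fedosov.
Variables (R : realType) (d : nat) (M : manifold R (d + d)).
Variable omega : symplectic_form M.
Local Notation F := (Cinfty M).

(* The 1-form A is stored as fed_A = i hbar A, with values in W; the degree   *)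
(* of its components is then shifted by 2, so A_(-1) is the part of degree 1  *)
(* of fed_A, and there is no part of degree 0. The connection is given by its *)
(* values on Gamma(W), which determine it on all W-valued forms since it is a *)
(* graded derivation. That it is C[[hbar]]-linear, a derivation, and d on     *)
(* functions is automatic from fed_conE.                                      *)
Record fedosov := Fedosov {
  fed_nabla : symplectic_connection omega;
  fed_D0 : vfield M -> wsection M -> wsection M;
  fed_D0E : forall X s l (Ys : seq (vfield M)) x,
    fed_D0 X s x l (map (vf_at x) Ys) =
    (X (wcoef s l Ys) : F) x -
    \sum_(i < size Ys)
      s x l (map (vf_at x) (set_nth 0 Ys i (fed_nabla X (nth 0 Ys i))));
  fed_A : vfield M -> wsection M;
  fed_A_lin : forall (f : F) (X Y : vfield M) x l ys,
    fed_A (f *: X + Y) x l ys = f x * fed_A X x l ys + fed_A Y x l ys;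
  fed_A_deg0 : forall X x, fed_A X x 0 [::] = 0;
  fed_A_deg1 : forall X x v, fed_A X x 0 [:: v] = omega x (vf_at x X) v;
  fed_con :> vfield M -> wsection M -> wsection M;
  fed_conE : forall X s x l ys,
    fed_con X s x l ys =
    fed_D0 X s x l ys + wad omega (fed_A X x) (s x) l ys;
  fed_flat : forall X Y s x l ys,
    fed_con X (fed_con Y s) x l ys - fed_con Y (fed_con X s) x l ys
    - fed_con (vf_bracket X Y) s x l ys = 0 }.

(* i hbar Omega_A = R_0 + nabla_0 (i hbar A) + (i hbar / 2) [A, A] is equal   *)
(* to omega + i hbar theta; it is evaluated on a pair of vector fields, where *)
(* [A, A] / 2 becomes [A(X), A(Y)].                                           *)
Definition has_curvature (D : fedosov) (theta : nat -> form2 M) :=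
  exists R0 : vfield M -> vfield M -> wsection M,
  [/\ forall X Y x l ys, (l != 0)%N || (size ys != 2)%N -> R0 X Y x l ys = 0,
      forall X Y s x l ys,
        fed_D0 D X (fed_D0 D Y s) x l ys - fed_D0 D Y (fed_D0 D X s) x l ys
        - fed_D0 D (vf_bracket X Y) s x l ys
        = wad omega (R0 X Y x) (s x) l ys
    & forall X Y x l ys,
        R0 X Y x l ys
        + (fed_D0 D X (fed_A D Y) x l ys - fed_D0 D Y (fed_A D X) x l ys
           - fed_A D (vf_bracket X Y) x l ys)
        + wad omega (fed_A D X x) (fed_A D Y x) l ys
        = match ys, l with
          | [::], 0%N => omega x (vf_at x X) (vf_at x Y)
          | [::], k.+1 => 'i * theta k x (vf_at x X) (vf_at x Y)
          | _, _ => 0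
          end].

Definition con_pull (g : diffeo M) (D : vfield M -> wsection M -> wsection M)
    (X : vfield M) (s : wsection M) : wsection M :=
  wpull g (D (vpush g X) (wpull (dinv g) s)).

Definition con_invariant (g : diffeo M) (c : G1_section omega) (D : fedosov) :=
  forall X s, c (con_pull g D X (g1_inv c s)) = D X s.

Definition Clinear (P : F -> F) := forall (a : R[i]) f g, P (a *: f + g) = a *: P f + P g.

(* Order of a differential operator: P has order <= 0 if it is C^oo-linear,   *)
(* and order <= N + 1 if all commutators [P, f] have order <= N.              *)
Fixpoint diffop_order (N : nat) (P : F -> F) : Prop :=
  if N is N'.+1 then forall f, diffop_order N' (fun g => P (f * g) - f * P g)
  else forall f g, P (f * g) = f * P g.

Definition diffop (P : F -> F) := Clinear P /\ exists N, diffop_order N P.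

Definition bidiffop (B : F -> F -> F) := exists N, forall f,
  [/\ Clinear (B f), Clinear (B^~ f),
      diffop_order N (B f) & diffop_order N (B^~ f)].

Definition fseries := nat -> F.

Definition fseries_add (f g : fseries) : fseries := fun m => f m + g m.

Definition fseries_scale (a : nat -> R[i]) (f : fseries) : fseries :=
  fun m => \sum_(i < m.+1) a i *: f (m - i)%N.

Definition star_of (B : nat -> F -> F -> F) (f g : fseries) : fseries :=
  fun m => \sum_(i < m.+1) \sum_(j < (m - i).+1) B (m - i - j)%N (f i) (g j).

Record deformation_quantization := DeformationQuantization {
  dq_B : nat -> F -> F -> F;
  dq_B0 : forall f g, dq_B 0 f g = f * g;
  dq_bidiff : forall k, bidiffop (dq_B k);
  dq_poisson : forall f g x,
    (dq_B 1 f g - dq_B 1 g f : F) x = 'i * poisson omega f g x;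
  dq_assoc : associative (star_of dq_B);
  dq_left1 : left_id (fun m => if m is 0%N then 1 else 0) (star_of dq_B);
  dq_right1 : right_id (fun m => if m is 0%N then 1 else 0) (star_of dq_B) }.

Definition star (A : deformation_quantization) := star_of (dq_B A).

Definition dq_automorphism (A : deformation_quantization)
    (phi : fseries -> fseries) :=
  [/\ bijective phi,
      forall f g, phi (fseries_add f g) = fseries_add (phi f) (phi g),
      forall a f, phi (fseries_scale a f) = fseries_scale a (phi f)
    & forall f g, phi (star A f g) = star A (phi f) (phi g)].

(* q : A -> ker D is an isomorphism of C[[hbar]]-algebras which becomes a     *)
(* gauge equivalence T = id + hbar T_1 + ... when ker D is identified with    *)
(* C^oo(M)[[hbar]] by taking symbols, that is by a |-> a_x(0).                *)
Definition kernel_iso (A : deformation_quantization) (D : fedosov)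
    (q : fseries -> wsection M) :=
  [/\ injective q,
      forall s, (forall X x l ys, D X s x l ys = 0) <-> (exists f, q f = s),
      forall a f g x l ys, q (fseries_add (fseries_scale a f) g) x l ys =
        \sum_(i < l.+1) a i * q f x (l - i)%N ys + q g x l ys,
      forall f g x l ys, q (star A f g) x l ys = wmul omega (q f x) (q g x) l ys
    & exists T : nat -> F -> F,
      [/\ forall f, T 0 f = f, forall k, diffop (T k)
        & forall f x l, q f x l [::] = \sum_(i < l.+1) (T (l - i)%N (f i) : F) x]].

Definition char_class (A : deformation_quantization) (theta : nat -> form2 M) :=
  (forall k, closed2 (theta k)) /\
  exists D q theta', [/\ kernel_iso A D q, has_curvature D theta'
                       & forall k, cohomologous (theta' k) (theta k)].

Definition symp_stabilizer (theta : nat -> form2 M) (g : diffeo M) :=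
  symplecto omega g /\ forall k, cohomologous (form2_pull g (theta k)) (theta k).

Section Action.
Variables (G : groupType) (rho : G -> diffeo M).

Definition extended_action (A : deformation_quantization)
    (alpha : G -> fseries -> fseries) :=
  [/\ forall g, dq_automorphism A (alpha g),
      forall g h f, alpha g (alpha h f) = alpha (h * g)%g f
    & exists D q (c : G -> G1_section omega),
      [/\ kernel_iso A D q,
          forall g f, q (alpha g f) = c g (wpull (rho g) (q f))
        & forall g, con_invariant (rho g) (c g) D]].

Definition G1_act (g : diffeo M) (c : wsection M -> wsection M) (s : wsection M) :=
  wpull g (c (wpull (dinv g) s)).

Definition cocycle (c : G -> G1_section omega) := forall g h s,
  c g (G1_act (rho g) (c h) (g1_inv (c (h * g)%g) s)) = s.

End Action.
End Fedosov.

(* Main.v *)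
(** A flat section s = q f satisfies s_x = f(x) + d_x f + terms of degree at
    least 2. Products and combinations of flat sections are again flat, and by
    Euler's identity the Weyl products of generators span each degree, so at a
    point with a symplectic frame the values of flat sections are dense in the
    Weyl algebra W_x for the degree filtration. Hence associativity of the star
    product forces associativity of W_x, the operators exp((1/(i hbar)) [w, -])
    are continuous automorphisms, and an identity between such operators which
    holds on flat sections holds on all sections. An extended action therefore
    gives a cocycle, and a cocycle acts on the kernel of the connection through
    c_g g^*. Without using that T_xM has dimension 2d, a point without a
    symplectic frame is treated apart: there [w, -] = 0 and G_1 acts trivially. *)
Require Import Defs.
From HB Require Import structures.
From mathcomp Require Import all_boot all_order all_algebra complex.
From mathcomp Require Import all_classical all_reals all_analysis.
From mathcomp Require Import ring.

Set Implicit Arguments.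
Unset Strict Implicit.
Unset Printing Implicit Defensive.

Import Order.TTheory GRing.Theory Num.Theory.

Local Open Scope ring_scope.
Local Open Scope complex_scope.

(* The unqualified name is shadowed by a lemma of mathcomp. *)
Local Notation dinv := Defs.dinv.

(** * Splittings and the Moyal product *)

Lemma triangle_sumC (V : nmodType) (F : nat -> nat -> V) n :
  \sum_(i < n.+1) \sum_(j < (n - i).+1) F i j =
  \sum_(j < n.+1) \sum_(i < (n - j).+1) F i j.
Proof.
have E (G : nat -> nat -> V) : \sum_(i < n.+1) \sum_(j < (n - i).+1) G i j =
    \sum_(i < n.+1) \sum_(j < n.+1 | (i + j <= n)%N) G i j.
  apply: eq_bigr => i _; rewrite (big_ord_widen n.+1 (G i)) ?ltnS ?leq_subr //.
  by apply: eq_bigl => j; rewrite ltnS leq_subRL // -ltnS.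
rewrite (E F) (E (fun j i => F i j)) (exchange_big_dep xpredT) //=.
by apply: eq_bigr => j _; apply: eq_bigl => i; rewrite addnC.
Qed.

Lemma sumr_antisym (K : numDomainType) n (F : 'I_n -> 'I_n -> K) :
  (forall i j, F j i = - F i j) -> \sum_i \sum_j F i j = 0.
Proof.
move=> H; set S := LHS.
suff /eqP : S = - S by rewrite -addr_eq0 -mulr2n mulrn_eq0 /= => /eqP.
rewrite {1}/S exchange_big -sumrN; apply: eq_bigr => i _.
by rewrite -sumrN; apply: eq_bigr => j _.
Qed.

Section Splits.
Variables (V : Type) (K : nzRingType).
Implicit Types (ys us vs : seq V) (G : seq V -> seq V -> K).

(** The Leibniz rule: each argument goes to one of two factors. The masks are those of [wmul], so
    that [wmul] unfolds to [moyal] by conversion. *)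
Definition splits ys G : K :=
  \sum_(m : (size ys).-tuple bool) G (mask m ys) (mask (map negb m) ys).

Lemma splits_nil G : splits [::] G = G [::] [::].
Proof.
rewrite /splits (big_pred1 [tuple]) // => m.
by rewrite (tuple0 m); apply/esym/eqP; exact: val_inj.
Qed.

Lemma splits_cons y ys G : splits (y :: ys) G =
  splits ys (fun us vs => G (y :: us) vs) + splits ys (fun us vs => G us (y :: vs)).
Proof.
rewrite /splits (reindex (fun p : bool * (size ys).-tuple bool => cons_tuple p.1 p.2)) /=.
  rewrite -(pair_bigA _ (fun b (t : (size ys).-tuple bool) =>
    G (mask (b :: t) (y :: ys)) (mask (map negb (b :: t)) (y :: ys)))) /=.
  by rewrite big_bool.
exists (fun t : (size (y :: ys)).-tuple bool => (thead t, [tuple of behead t])).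
  by move=> [b t] _; congr (_, _); apply: val_inj.
by move=> t _; rewrite [RHS]tuple_eta; apply: val_inj.
Qed.

Lemma eq_splits ys G G' :
  (forall us vs, (size us + size vs = size ys)%N -> G us vs = G' us vs) ->
  splits ys G = splits ys G'.
Proof.
elim: ys G G' => [|y ys IH] G G' H; first by rewrite !splits_nil; exact: H.
by rewrite !splits_cons; congr (_ + _); apply: IH => us vs E; apply: H;
  rewrite /= ?addnS ?addSn E.
Qed.

Lemma splitsC ys G : splits ys G = splits ys (fun us vs => G vs us).
Proof.
elim: ys G => [|y ys IH] G; first by rewrite !splits_nil.
by rewrite !splits_cons addrC; congr (_ + _); rewrite IH.
Qed.

Lemma splits_lin c ys G G' :
  splits ys (fun us vs => c * G us vs + G' us vs) = c * splits ys G + splits ys G'.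
Proof. by rewrite /splits big_split mulr_sumr. Qed.

Lemma splits_head (A : seq V -> K) ys :
  splits ys (fun us vs => if us is [::] then A vs else 0) = A ys.
Proof.
elim: ys A => [|y ys IH] A; first by rewrite splits_nil.
rewrite splits_cons (IH (fun vs => A (y :: vs))) [X in X + _](_ : _ = 0) ?add0r //.
by rewrite /splits big1.
Qed.

End Splits.

Lemma splits_map (V W : Type) (K : nzRingType) (f : V -> W) ys
    (G : seq W -> seq W -> K) :
  splits (map f ys) G = splits ys (fun us vs => G (map f us) (map f vs)).
Proof.
elim: ys G => [|y ys IH] G; first by rewrite !splits_nil.
by rewrite /= !splits_cons !IH.
Qed.

(** Each of the [size ys] ways to single out one entry contributes [A ys], since moving that entry
    to the front is a permutation. *)
Lemma splits_singleton (V : eqType) (K : nzRingType) (A : seq V -> K) ys :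
  (forall us vs, perm_eq us vs -> A us = A vs) ->
  splits ys (fun us vs => if us is [:: u] then A (u :: vs) else 0) =
  (size ys)%:R * A ys.
Proof.
elim: ys A => [|y ys IH] A symA; first by rewrite splits_nil mul0r.
rewrite splits_cons /= mulrSr mulrDl mul1r addrC; congr (_ + _); last first.
  rewrite -(splits_head (fun vs => A (y :: vs))).
  by apply: eq_splits; case.
rewrite -(IH (fun vs => A (y :: vs))); last first.
  by move=> us vs uv; apply: symA; rewrite perm_cons.
apply: eq_splits => -[|u [|u' us]] vs _ //; apply: symA.
by apply/permP => p /=; rewrite addnCA.
Qed.

(* A symbol a stands for the formal power series sum_l hbar^l a_l on V, with  *)
(* a l [:: y_1; ...; y_k] the k-th derivative of a_l at 0; its (l, k)         *)
(* component has degree 2 l + k.                                              *)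
Section Moyal.
Variables (K : numFieldType) (V : lmodType K) (n : nat) (J : 'M[K]_n).
Local Notation symbol := (nat -> seq V -> K).
Implicit Types (e : 'I_n -> V) (h : seq V -> seq V -> K) (a b c w : symbol).
Implicit Types (ys zs us vs : seq V).

Definition contr e h ys zs := \sum_i \sum_j J i j * h (e i :: ys) (e j :: zs).

Lemma eq_iter_contr e r h h' ys zs :
  (forall us vs, size us = (r + size ys)%N -> size vs = (r + size zs)%N ->
     h us vs = h' us vs) ->
  iter r (contr e) h ys zs = iter r (contr e) h' ys zs.
Proof.
elim: r ys zs => [|r IH] ys zs H; first exact: H.
rewrite /= /contr; apply: eq_bigr => i _; apply: eq_bigr => j _; congr (_ * _).
by apply: IH => us vs Hu Hv; apply: H; rewrite ?Hu ?Hv /= addnS addSn.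
Qed.

Lemma iter_contr_lin e r (k : K) h h' ys zs :
  iter r (contr e) (fun us vs => k * h us vs + h' us vs) ys zs =
  k * iter r (contr e) h ys zs + iter r (contr e) h' ys zs.
Proof.
elim: r ys zs => [|r IH] ys zs //=; rewrite /contr mulr_sumr -big_split /=.
apply: eq_bigr => i _; rewrite mulr_sumr -big_split /=; apply: eq_bigr => j _.
by rewrite IH mulrDr; congr (_ + _); rewrite mulrCA.
Qed.

Definition bidiff e r h ys := splits ys (iter r (contr e) h).

Lemma eq_bidiff e r h h' ys :
  (forall us vs, (size us + size vs = r.*2 + size ys)%N -> h us vs = h' us vs) ->
  bidiff e r h ys = bidiff e r h' ys.
Proof.
move=> H; apply: eq_splits => us vs E; apply: eq_iter_contr => us' vs' Eu Ev.
by apply: H; rewrite Eu Ev addnACA addnn E.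
Qed.

Lemma bidiff_lin e r k h h' ys :
  bidiff e r (fun us vs => k * h us vs + h' us vs) ys =
  k * bidiff e r h ys + bidiff e r h' ys.
Proof.
by rewrite -splits_lin; apply: eq_splits => us vs _; rewrite iter_contr_lin.
Qed.

Lemma bidiff0 e r ys : bidiff e r (fun _ _ => 0) ys = 0.
Proof.
rewrite (@eq_bidiff e r _ (fun us vs => -1 * 0 + 0)).
  by rewrite bidiff_lin mulN1r addNr.
by move=> us vs _; rewrite mulr0 addr0.
Qed.

Lemma bidiffZ e r k h ys :
  bidiff e r (fun us vs => k * h us vs) ys = k * bidiff e r h ys.
Proof.
rewrite -[RHS]addr0 -[X in _ + X](bidiff0 e r ys) -bidiff_lin.
by apply: eq_bidiff => us vs _; rewrite addr0.
Qed.

Lemma bidiff_sum e r (m : nat) (H : 'I_m -> seq V -> seq V -> K) ys :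
  bidiff e r (fun us vs => \sum_(i < m) H i us vs) ys =
  \sum_(i < m) bidiff e r (H i) ys.
Proof.
elim: m H => [|m IH] H.
  rewrite big_ord0 -[RHS](bidiff0 e r ys).
  by apply: eq_bidiff => us vs _; rewrite big_ord0.
rewrite big_ord_recl -IH -[X in X + _]mul1r -bidiff_lin.
by apply: eq_bidiff => us vs _; rewrite big_ord_recl mul1r.
Qed.

Definition moyal e (k : K) a b : symbol := fun l ys =>
  \sum_(r < l.+1) \sum_(p < (l - r).+1)
    k ^+ r / r`!%:R * bidiff e r (fun us vs => a p us * b (l - r - p)%N vs) ys.

(** Each contraction uses up two arguments and raises the power of hbar by one, so total degree is
    preserved. The hypothesis compares products rather than factors, so that either factor may serve
    to make a term vanish. *)
Lemma eq_moyal e k a b a' b' l ys :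
  (forall p us q vs,
     (p.*2 + size us + (q.*2 + size vs) = l.*2 + size ys)%N ->
     a p us * b q vs = a' p us * b' q vs) ->
  moyal e k a b l ys = moyal e k a' b' l ys.
Proof.
move=> H; apply: eq_bigr => r _; apply: eq_bigr => p _; congr (_ * _).
apply: eq_bidiff => us vs E; apply: H.
have rl : (r <= l)%N by rewrite -ltnS.
have pl : (p <= l - r)%N by rewrite -ltnS.
rewrite addnACA E addnA -!doubleD subnKC //.
by rewrite subnK.
Qed.

Lemma moyal0r e k a l ys : moyal e k a (fun _ _ => 0) l ys = 0.
Proof.
rewrite /moyal big1 // => r _; rewrite big1 // => p _.
rewrite (_ : bidiff _ _ _ _ = 0) ?mulr0 // -[RHS](bidiff0 e r ys).
by apply: eq_bidiff => us vs _; rewrite mulr0.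
Qed.

Lemma moyal_linr e k a b b' (t : K) l ys :
  moyal e k a (fun l ys => t * b l ys + b' l ys) l ys =
  t * moyal e k a b l ys + moyal e k a b' l ys.
Proof.
rewrite /moyal mulr_sumr -big_split; apply: eq_bigr => r _ /=.
rewrite mulr_sumr -big_split; apply: eq_bigr => p _ /=.
rewrite [t * _]mulrCA -mulrDr -bidiff_lin; congr (_ * _).
by apply: eq_bidiff => us vs _; rewrite mulrDr mulrCA.
Qed.

Definition vanishes_below s a :=
  forall l ys, (l.*2 + size ys < s)%N -> a l ys = 0.

Lemma moyal_ge e k a b s t : vanishes_below s a -> vanishes_below t b ->
  vanishes_below (s + t) (moyal e k a b).
Proof.
move=> Ha Hb l ys lt_st.
rewrite (@eq_moyal _ _ _ _ a (fun _ _ => 0)) ?moyal0r // => p us q vs E.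
rewrite mulr0; case: (ltnP (p.*2 + size us) s) => Hs; first by rewrite Ha ?mul0r.
rewrite Hb ?mulr0 // -(ltn_add2l s); apply: leq_ltn_trans lt_st.
by rewrite -E leq_add2r.
Qed.

(** Multiplication by the formal series with coefficients [t]. *)
Definition hscale (t : nat -> K) a : symbol :=
  fun l ys => \sum_(i < l.+1) t i * a (l - i)%N ys.

Lemma moyal_scaler e k t a b l ys :
  moyal e k a (hscale t b) l ys = hscale t (moyal e k a b) l ys.
Proof.
pose F r p i : K := t i * (k ^+ r / r`!%:R *
  bidiff e r (fun us vs => a p us * b (l - r - p - i)%N vs) ys).
transitivity (\sum_(r < l.+1) \sum_(p < (l - r).+1) \sum_(i < (l - r - p).+1) F r p i).
  apply: eq_bigr => r _; apply: eq_bigr => p _.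
  rewrite /F; under [RHS]eq_bigr do rewrite mulrCA.
  rewrite -mulr_sumr; congr (_ * _); under [RHS]eq_bigr do rewrite -bidiffZ.
  rewrite -bidiff_sum; apply: eq_bidiff => us vs _; rewrite mulr_sumr.
  by apply: eq_bigr => i _; rewrite mulrCA.
under eq_bigr do rewrite triangle_sumC.
rewrite (triangle_sumC (fun r i => \sum_(p < (l - r - i).+1) F r p i)).
rewrite /hscale; apply: eq_bigr => i _; rewrite mulr_sumr; apply: eq_bigr => r _.
rewrite mulr_sumr subnAC; apply: eq_bigr => p _; rewrite /F.
by rewrite [(l - r - p - i)%N]subnAC [(l - r - i)%N]subnAC.
Qed.

Section Antisymmetric.
Hypothesis J_anti : forall i j, J i j = - J j i.

Lemma iter_contr_swap e r h ys zs :
  iter r (contr e) (fun us vs => h vs us) ys zs =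
  (-1) ^+ r * iter r (contr e) h zs ys.
Proof.
elim: r ys zs => [|r IH] ys zs; first by rewrite mul1r.
rewrite /= /contr exchange_big mulr_sumr /=; apply: eq_bigr => i _.
rewrite mulr_sumr; apply: eq_bigr => j _.
by rewrite IH J_anti exprS; ring.
Qed.

Lemma bidiff_swap e r h ys :
  bidiff e r (fun us vs => h vs us) ys = (-1) ^+ r * bidiff e r h ys.
Proof.
rewrite /bidiff splitsC {2}/splits mulr_sumr; apply: eq_bigr => m _.
exact: iter_contr_swap.
Qed.

(** Exchanging the factors reverses the sign of every contraction. Statements about the left factor
    thus reduce to those about the right one, for arbitrary [k]. *)
Lemma moyal_swap e k a b l ys : moyal e k a b l ys = moyal e (- k) b a l ys.
Proof.
apply: eq_bigr => r _; rewrite (reindex_inj rev_ord_inj) /=.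
apply: eq_bigr => p _; rewrite subSS subKn -1?ltnS //.
rewrite (@eq_bidiff _ _ _ (fun us vs => b p vs * a (l - r - p)%N us)); last first.
  by move=> us vs _; rewrite mulrC.
rewrite (bidiff_swap _ _ (fun us vs => b p us * a (l - r - p)%N vs)).
by rewrite [in RHS]exprNn mulrCA !mulrA.
Qed.

End Antisymmetric.
End Moyal.

(** * The adjoint action and its exponential *)

Section WeylAlgebra.
Variables (K : numFieldType) (V : lmodType K) (n : nat) (J : 'M[K]_n).
Hypothesis J_anti : forall i j, J i j = - J j i.
Local Notation symbol := (nat -> seq V -> K).
Variable e : 'I_n -> V.
Implicit Types (h : seq V -> seq V -> K) (a b c w : symbol).
Implicit Types (ys zs us vs : seq V).
Local Notation moyal := (moyal J e).

Lemma moyal_linl k a a' b (t : K) l ys :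
  moyal k (fun l ys => t * a l ys + a' l ys) b l ys =
  t * moyal k a b l ys + moyal k a' b l ys.
Proof. by rewrite moyal_swap // moyal_linr -!(moyal_swap J_anti). Qed.

Lemma moyal0l k b l ys : moyal k (fun _ _ => 0) b l ys = 0.
Proof. by rewrite moyal_swap // moyal0r. Qed.

Lemma moyal_sumr k a m (t : 'I_m -> K) (B : 'I_m -> symbol) l ys :
  moyal k a (fun l ys => \sum_(i < m) t i * B i l ys) l ys =
  \sum_(i < m) t i * moyal k a (B i) l ys.
Proof.
elim: m t B => [|m IH] t B.
  rewrite big_ord0 -[RHS](moyal0r J e k a l ys); apply: eq_moyal => p us q vs _.
  by rewrite big_ord0.
rewrite big_ord_recl -(IH (fun i => t (lift ord0 i))) -moyal_linr.
by apply: eq_moyal => p us q vs _; rewrite big_ord_recl.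
Qed.

Lemma moyal_suml k m (t : 'I_m -> K) (A : 'I_m -> symbol) b l ys :
  moyal k (fun l ys => \sum_(i < m) t i * A i l ys) b l ys =
  \sum_(i < m) t i * moyal k (A i) b l ys.
Proof.
rewrite moyal_swap // moyal_sumr; apply: eq_bigr => i _.
by rewrite -(moyal_swap J_anti).
Qed.

(** Linearity in the first argument suffices, because symmetry carries it to the others. *)
Definition symlin (u : seq V -> K) :=
  (forall ys zs, perm_eq ys zs -> u ys = u zs) /\
  (forall t (v v' : V) ys, u (t *: v + v' :: ys) = t * u (v :: ys) + u (v' :: ys)).

Definition multilin a := forall l, symlin (a l).

Lemma symlin_sum u m (t : 'I_m -> K) (v : 'I_m -> V) ys : symlin u ->
  u (\sum_(i < m) t i *: v i :: ys) = \sum_(i < m) t i * u (v i :: ys).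
Proof.
move=> [_ lin]; elim: m t v => [|m IH] t v; last first.
  by rewrite !big_ord_recl lin IH.
rewrite !big_ord0 -[in LHS](addr0 0) -[X in X + _](scaler0 _ (-1)) lin mulN1r.
by rewrite addNr.
Qed.

Lemma multilin_lin a b t : multilin a -> multilin b ->
  multilin (fun l ys => t * a l ys + b l ys).
Proof.
move=> Ha Hb l; have [sa la] := Ha l; have [sb lb] := Hb l; split=> [ys zs yz|s u v ys].
  by rewrite (sa _ _ yz) (sb _ _ yz).
by rewrite la lb; ring.
Qed.

Definition cov (phi : V -> K) : symbol := fun l ys =>
  match l, ys with 0%N, [:: y] => phi y | _, _ => 0 end.

(** A covector has no second derivative, so only the terms with zero or one contraction survive. *)
Lemma moyal_cov k phi b l ys :
  moyal k (cov phi) b l ys =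
  splits ys (fun us vs => if us is [:: u] then phi u * b l vs else 0) +
  (if l is l'.+1 then
     k * \sum_i \sum_j J i j * (phi (e i) * b l' (e j :: ys)) else 0).
Proof.
have inner r m : \sum_(p < m.+1) k ^+ r / r`!%:R *
     bidiff J e r (fun us vs => cov phi p us * b (m - p)%N vs) ys =
   k ^+ r / r`!%:R * bidiff J e r (fun us vs => cov phi 0 us * b m vs) ys.
  rewrite big_ord_recl subn0 big1 ?addr0 // => p _.
  rewrite (_ : bidiff _ _ _ _ _ = 0) ?mulr0 // -[RHS](bidiff0 J e r ys).
  by apply: eq_bidiff => us vs _; rewrite /= mul0r.
rewrite /moyal; under eq_bigr do rewrite inner.
rewrite big_ord_recl expr0 divr1 mul1r subn0; congr (_ + _).
  by apply: eq_splits => -[|u [|u' us]] vs _ /=; rewrite ?mul0r.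
case: l => [|l]; first by rewrite big_ord0.
rewrite big_ord_recl big1 ?addr0.
  rewrite expr1 divr1 subSS subn0; congr (_ * _).
  rewrite -(splits_head (fun vs => \sum_i \sum_j J i j * (phi (e i) * b l (e j :: vs)))).
  apply: eq_splits => -[|u us] vs _ //=; rewrite /contr.
  by rewrite big1 // => i _; rewrite big1 // => j _; rewrite mul0r mulr0.
move=> r _; rewrite (_ : bidiff _ _ _ _ _ = 0) ?mulr0 // -[RHS](bidiff0 J e r.+2 ys).
apply: eq_splits => us vs _; apply: eq_iter_contr => us' vs' E _.
by case: us' E => [|? [|? ?]] //= _; rewrite mul0r.
Qed.

(* Euler's identity; the contraction terms cancel because J is antisymmetric  *)
(* and second derivatives are symmetric.                                      *)
Lemma euler_moyal k (phi : 'I_n -> V -> K) a l ys : multilin a ->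
  (forall v, v = \sum_i phi i v *: e i) ->
  \sum_i moyal k (cov (phi i))
           (fun l ys => (size ys).+1%:R^-1 * a l (e i :: ys)) l ys =
  if ys is [::] then 0 else a l ys.
Proof.
move=> Ha dual; have [syma _] := Ha l.
have dualE l' v zs : \sum_i phi i v * a l' (e i :: zs) = a l' (v :: zs).
  by rewrite -symlin_sum // -dual.
under eq_bigr do rewrite moyal_cov.
rewrite big_split /= [X in _ + X](_ : _ = 0) ?addr0.
  pose A us := (size us)%:R^-1 * a l us.
  transitivity ((size ys)%:R * A ys); last first.
    case: ys => [|y ys]; first by rewrite mul0r.
    by rewrite mulrA mulfV ?mul1r // pnatr_eq0.
  rewrite -splits_singleton; last first.
    by move=> us vs uv; rewrite /A (perm_size uv) (syma _ _ uv).
  rewrite /splits exchange_big; apply: eq_bigr => m _ /=.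
  case: (mask m ys) => [|u [|u' us]]; [by rewrite big1 | | by rewrite big1].
  rewrite /A -dualE mulr_sumr; apply: eq_bigr => i _; exact: mulrCA.
case: l {syma} => [|l]; first by rewrite big1.
rewrite -mulr_sumr [X in _ * X](_ : _ = 0) ?mulr0 //.
have [syma _] := Ha l.
transitivity (\sum_i \sum_j J i j * ((size ys).+2%:R^-1 * a l (e i :: e j :: ys))).
  rewrite exchange_big; apply: eq_bigr => i _; rewrite exchange_big.
  apply: eq_bigr => j _; rewrite -dualE !mulr_sumr; apply: eq_bigr => s _ /=.
  by congr (_ * _); rewrite mulrCA.
apply: sumr_antisym => i j; rewrite (J_anti j i) mulNr (syma _ [:: e i, e j & ys]) //.
by apply/permP => p /=; rewrite addnCA.
Qed.

Section Exponential.
Variable hb : K.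
Hypothesis hb0 : hb != 0.
Local Notation prod := (moyal (hb / 2)).

(** Division by hbar is the shift to [l.+1]; it loses nothing, because the hbar^0 part of the
    product is commutative. *)
Definition ad w a : symbol := fun l ys =>
  (prod w a l.+1 ys - prod a w l.+1 ys) / hb.

Definition expad w a : symbol := fun l ys =>
  \sum_(k < (l.*2 + size ys).+1) (k`!%:R)^-1 * iter k (ad w) a l ys.

Lemma prod_comm0 a b ys : prod a b 0 ys = prod b a 0 ys.
Proof.
rewrite moyal_swap // /moyal !big_ord_recl !big_ord0.
by rewrite !expr0.
Qed.

Lemma ad_lin w t a b l ys :
  ad w (fun l ys => t * a l ys + b l ys) l ys = t * ad w a l ys + ad w b l ys.
Proof. by rewrite /ad moyal_linr moyal_linl; ring. Qed.

Lemma ad0 w l ys : ad w (fun _ _ => 0) l ys = 0.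
Proof. by rewrite /ad moyal0l moyal0r subr0 mul0r. Qed.

Lemma ad_sum w m (t : 'I_m -> K) (A : 'I_m -> symbol) l ys :
  ad w (fun l ys => \sum_(i < m) t i * A i l ys) l ys =
  \sum_(i < m) t i * ad w (A i) l ys.
Proof.
rewrite /ad moyal_sumr moyal_suml -sumrB mulr_suml; apply: eq_bigr => i _.
by rewrite -mulrBr mulrA.
Qed.

(** The product with [w] raises the degree by 3, and dividing by hbar lowers it by 2. *)
Lemma ad_ge w a s : vanishes_below 3 w -> vanishes_below s a ->
  vanishes_below s.+1 (ad w a).
Proof.
move=> w3 Ha l ys H; rewrite /ad.
rewrite (moyal_ge _ _ _ w3 Ha) ?(moyal_ge _ _ _ Ha w3) ?subr0 ?mul0r //;
  by rewrite doubleS 2!addSn ?addn3 ?add3n !ltnS.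
Qed.

Lemma ad_hscale w t a l ys : ad w (hscale t a) l ys = hscale t (ad w a) l ys.
Proof.
rewrite /ad moyal_scaler (moyal_swap J_anti) moyal_scaler /hscale -sumrB.
(* The sum at order [l.+1] has one term too many; it multiplies the commutator at order 0, which is
   zero. *)
rewrite big_ord_recr /= subnn -(moyal_swap J_anti) prod_comm0 subrr addr0.
rewrite mulr_suml; apply: eq_bigr => i _.
by rewrite -(moyal_swap J_anti) subSn -1?ltnS // -mulrBr mulrA.
Qed.

(** The terms without contraction cancel, and the two orders of the factors each supply half of the
    bracket. *)
Lemma ad_degree0 a b :
  ad a b 0 [::] = \sum_i \sum_j J i j * (a 0%N [:: e i] * b 0%N [:: e j]).
Proof.
have E c c' : prod c c' 1 [::] = c 0%N [::] * c' 1%N [::] + c 1%N [::] * c' 0%N [::] +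
    hb / 2 * \sum_i \sum_j J i j * (c 0%N [:: e i] * c' 0%N [:: e j]).
  rewrite /moyal !big_ord_recl !big_ord0 /bidiff !splits_nil /=.
  by rewrite /contr expr0 expr1 !divr1 !mul1r !addr0.
rewrite /ad !E; set S1 := \sum_i _; set S2 := \sum_i _.
have -> : S2 = - S1.
  rewrite /S1 /S2 exchange_big /= -sumrN; apply: eq_bigr => i _.
  rewrite -sumrN; apply: eq_bigr => j _.
  by rewrite (J_anti j i) mulNr (mulrC (a _ _)).
by field.
Qed.

Lemma iter_ad_lin w t a b k l ys :
  iter k (ad w) (fun l ys => t * a l ys + b l ys) l ys =
  t * iter k (ad w) a l ys + iter k (ad w) b l ys.
Proof.
elim: k l ys => //= k IH l ys; rewrite -ad_lin; congr (ad w _ l ys).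
by apply/funext => l'; apply/funext => ys'; exact: IH.
Qed.

Lemma iter_ad_ge w a s k : vanishes_below 3 w -> vanishes_below s a ->
  vanishes_below (k + s) (iter k (ad w) a).
Proof. by move=> w3 Ha; elim: k => //= k IH; exact: ad_ge. Qed.

Lemma iter_ad_hscale w t a k l ys :
  iter k (ad w) (hscale t a) l ys = hscale t (iter k (ad w) a) l ys.
Proof.
elim: k l ys => //= k IH l ys; rewrite -ad_hscale; congr (ad w _ l ys).
by apply/funext => l'; apply/funext => ys'; exact: IH.
Qed.

Lemma expad_lin w t a b l ys :
  expad w (fun l ys => t * a l ys + b l ys) l ys = t * expad w a l ys + expad w b l ys.
Proof.
rewrite /expad mulr_sumr -big_split; apply: eq_bigr => k _ /=.
by rewrite iter_ad_lin mulrDr mulrCA.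
Qed.

(** The [k]-th iterate starts in degree [k], so the series may be cut at any larger bound;
    components of different degree can then share one bound. *)
Lemma expad_trunc w a N l ys : vanishes_below 3 w ->
  (l.*2 + size ys <= N)%N ->
  expad w a l ys = \sum_(k < N.+1) (k`!%:R)^-1 * iter k (ad w) a l ys.
Proof.
move=> w3 lN.
rewrite /expad (big_ord_widen N.+1 (fun k => (k`!%:R)^-1 * iter k (ad w) a l ys)) //.
rewrite big_mkcond; apply: eq_bigr => k _; case: ltnP => // H.
by rewrite (iter_ad_ge (s := 0)) ?mulr0 ?addn0.
Qed.

Lemma expad_ge w a s : vanishes_below 3 w -> vanishes_below s a ->
  vanishes_below s (expad w a).
Proof.
move=> w3 Ha l ys H; rewrite /expad big1 // => k _.
by rewrite (iter_ad_ge w3 Ha) ?mulr0 // (leq_trans H) // leq_addl.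
Qed.

Lemma expad_hscale w t a l ys : vanishes_below 3 w ->
  expad w (hscale t a) l ys = hscale t (expad w a) l ys.
Proof.
move=> w3; transitivity (\sum_(i < l.+1) t i *
    \sum_(k < (l.*2 + size ys).+1) (k`!%:R)^-1 * iter k (ad w) a (l - i)%N ys).
  rewrite /expad; under [RHS]eq_bigr do rewrite mulr_sumr.
  rewrite exchange_big; apply: eq_bigr => k _ /=.
  rewrite iter_ad_hscale /hscale mulr_sumr; apply: eq_bigr => i _.
  by rewrite mulrCA.
apply: eq_bigr => i _; congr (_ * _); rewrite -expad_trunc //.
by rewrite leq_add2r leq_double leq_subr.
Qed.

(** * The exponential of an inner derivation as an automorphism *)

Section Automorphism.
Hypothesis prod_multilin : forall a b, multilin a -> multilin b -> multilin (prod a b).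
Hypothesis prodA : forall a b c l ys, multilin a -> multilin b -> multilin c ->
  prod a (prod b c) l ys = prod (prod a b) c l ys.

Lemma ad_multilin w a : multilin w -> multilin a -> multilin (ad w a).
Proof.
move=> Hw Ha l; have [s1 l1] := prod_multilin Hw Ha l.+1.
have [s2 l2] := prod_multilin Ha Hw l.+1; split=> [ys zs yz|t u v ys].
  by rewrite /ad (s1 _ _ yz) (s2 _ _ yz).
by rewrite /ad l1 l2; ring.
Qed.

Lemma hscale_ad w a l ys :
  hscale (fun i => (i == 1%N)%:R * hb) (ad w a) l ys = prod w a l ys - prod a w l ys.
Proof.
rewrite /hscale; case: l => [|l].
  by rewrite big_ord1 !mul0r prod_comm0 subrr.
rewrite 2!big_ord_recl big1 ?addr0 => [|i _]; last by rewrite !mul0r.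
by rewrite !mul0r add0r mul1r subSS subn0 mulrC divfK.
Qed.

(** After multiplication by [hb] times hbar this is [w, ab] = [w, a] b + a [w, b], which is
    associativity used three times. *)
Lemma ad_prod w a b l ys : multilin w -> multilin a -> multilin b ->
  ad w (prod a b) l ys = prod (ad w a) b l ys + prod a (ad w b) l ys.
Proof.
move=> Hw Ha Hb; apply: (mulfI hb0).
(* The series [hb] times hbar, which undoes the division in [ad]. *)
pose t (i : nat) : K := (i == 1%N)%:R * hb.
have shift c : hscale t c l.+1 ys = hb * c l ys.
  rewrite /hscale 2!big_ord_recl big1 => [|i _]; last by rewrite /t !mul0r.
  by rewrite /t !mul0r add0r addr0 mul1r subSS subn0.
rewrite mulrDr -(shift (ad w _)) -(shift (prod (ad w a) b)) -(shift (prod a (ad w b))).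
rewrite hscale_ad.
have -> : hscale t (prod (ad w a) b) l.+1 ys = prod (hscale t (ad w a)) b l.+1 ys.
  rewrite [RHS](moyal_swap J_anti) moyal_scaler; apply: eq_bigr => i _.
  by rewrite -(moyal_swap J_anti).
rewrite -moyal_scaler.
have E w' a' : hscale t (ad w' a') = fun l ys => (-1) * prod a' w' l ys + prod w' a' l ys.
  by apply/funext => l'; apply/funext => ys'; rewrite hscale_ad mulN1r addrC.
rewrite !E moyal_linl moyal_linr -(prodA _ _ Hw Ha Hb) -(prodA _ _ Ha Hb Hw).
by rewrite (prodA _ _ Ha Hw Hb); ring.
Qed.

Variable w : symbol.
Hypothesis w_multilin : multilin w.
Hypothesis w_ge3 : vanishes_below 3 w.

Lemma iter_ad_multilin k a : multilin a -> multilin (iter k (ad w) a).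
Proof. by move=> Ha; elim: k => //= k; exact: ad_multilin. Qed.

(** The higher Leibniz formula, divided by [k]! so that binomial coefficients become products of
    inverse factorials. *)
Lemma iter_ad_prod k a b l ys : multilin a -> multilin b ->
  (k`!%:R)^-1 * iter k (ad w) (prod a b) l ys =
  \sum_(i < k.+1) (i`!%:R)^-1 * ((k - i)`!%:R)^-1 *
    prod (iter i (ad w) a) (iter (k - i) (ad w) b) l ys.
Proof.
move=> Ha Hb; elim: k l ys => [|k IH] l ys; first by rewrite big_ord1 fact0 invr1 !mul1r.
pose M i j := (i`!%:R)^-1 * (j`!%:R)^-1 * prod (iter i (ad w) a) (iter j (ad w) b) l ys.
have fS i : (i.+1`!%:R)^-1 * i.+1%:R = (i`!%:R)^-1 :> K.
  by rewrite factS natrM invfM mulrC mulrA mulfV ?mul1r // pnatr_eq0.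
have k1 : k.+1%:R != 0 :> K by rewrite pnatr_eq0.
apply: (mulfI k1); rewrite mulrA [k.+1%:R * _]mulrC fS /=.
have -> : iter k (ad w) (prod a b) =
    fun l ys => \sum_(i < k.+1) (k`!%:R * ((i`!%:R)^-1 * ((k - i)`!%:R)^-1)) *
      prod (iter i (ad w) a) (iter (k - i) (ad w) b) l ys.
  apply/funext => l'; apply/funext => ys'.
  have kf : (k`!%:R)^-1 != 0 :> K by rewrite invr_eq0 pnatr_eq0 -lt0n fact_gt0.
  apply: (mulfI kf); rewrite IH mulr_sumr; apply: eq_bigr => i _.
  by rewrite !mulrA mulVf ?mul1r // -invr_eq0.
rewrite ad_sum mulr_sumr.
(* Differentiating the term (i, k - i) gives (i + 1, k - i) with weight i + 1 and (i, k - i + 1)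
   with weight k - i + 1. After reindexing, the two weights on each term add up to k + 1. *)
transitivity (\sum_(i < k.+1)
  (i.+1%:R * M i.+1 (k - i)%N + (k - i).+1%:R * M i (k - i).+1)).
  apply: eq_bigr => i _; rewrite ad_prod //; try exact: iter_ad_multilin.
  rewrite /M -!iterS.
  have kf : k`!%:R != 0 :> K by rewrite pnatr_eq0 -lt0n fact_gt0.
  rewrite -[k`!%:R * _ * _]mulrA mulKf // mulrDr; congr (_ + _).
    by rewrite -(fS i); ring.
  by rewrite -(fS (k - i)%N); ring.
rewrite big_split /= [in RHS]/= mulr_sumr.
have -> : \sum_(i < k.+1) i.+1%:R * M i.+1 (k - i)%N =
    \sum_(i < k.+2) i%:R * M i (k.+1 - i)%N.
  by rewrite [RHS]big_ord_recl mul0r add0r; apply: eq_bigr => i _; rewrite subSS.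
have -> : \sum_(i < k.+1) (k - i).+1%:R * M i (k - i).+1 =
    \sum_(i < k.+2) (k.+1 - i)%:R * M i (k.+1 - i)%N.
  rewrite [RHS]big_ord_recr /= subnn mul0r addr0; apply: eq_bigr => i _.
  by rewrite subSn // -ltnS.
rewrite -big_split; apply: eq_bigr => i _ /=.
by rewrite -mulrDl -natrD subnKC // -ltnS.
Qed.

(** The Cauchy product of two exponential series, with every sum cut at the degree [N] of the
    component considered. *)
Lemma expad_prod a b l ys : multilin a -> multilin b ->
  expad w (prod a b) l ys = prod (expad w a) (expad w b) l ys.
Proof.
move=> Ha Hb; set N := (l.*2 + size ys)%N.
pose G i j := (i`!%:R)^-1 * (j`!%:R)^-1 * prod (iter i (ad w) a) (iter j (ad w) b) l ys.
(* For degree reasons the square of indices in the product of the cut series carries only the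
   triangle i + j <= N. *)
have G0 i j : (N < i + j)%N -> G i j = 0.
  move=> H; rewrite /G (@moyal_ge _ _ _ _ _ _ _ _ i j) ?mulr0 //.
    by move=> p us Hp; rewrite (iter_ad_ge (s := 0)) ?addn0.
  by move=> p us Hp; rewrite (iter_ad_ge (s := 0)) ?addn0.
transitivity (\sum_(i < N.+1) \sum_(j < N.+1) G i j); last first.
  rewrite (@eq_moyal _ _ _ _ _ _ _ _
    (fun l ys => \sum_(i < N.+1) (i`!%:R)^-1 * iter i (ad w) a l ys)
    (fun l ys => \sum_(i < N.+1) (i`!%:R)^-1 * iter i (ad w) b l ys)); last first.
    move=> p us q vs E; rewrite -/N in E.
    by rewrite !(@expad_trunc _ _ N) // -E ?leq_addr ?leq_addl.
  rewrite moyal_suml; apply: eq_bigr => i _; rewrite moyal_sumr mulr_sumr.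
  by apply: eq_bigr => j _; rewrite mulrA.
transitivity (\sum_(k < N.+1) \sum_(i < k.+1) G i (k - i)%N).
  by apply: eq_bigr => k _; rewrite iter_ad_prod.
rewrite (reindex_inj rev_ord_inj) /=; under eq_bigr do rewrite subSS.
rewrite (triangle_sumC (fun k i => G i (N - k - i)%N)); apply: eq_bigr => i _.
rewrite [RHS](bigID (fun j : 'I_N.+1 => (j < (N - i).+1)%N)) /= [X in _ + X]big1 ?addr0.
  rewrite -(big_ord_widen N.+1 (G i)) ?ltnS ?leq_subr //.
  rewrite (reindex_inj rev_ord_inj) /=; apply: eq_bigr => j _.
  by rewrite subSS [(N - _ - i)%N]subnAC subKn // -ltnS.
by move=> j; rewrite -leqNgt => H; apply: G0; rewrite -ltn_subLR // -ltnS.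
Qed.

End Automorphism.
End Exponential.
End WeylAlgebra.

(** * Change of frame *)

Section ZeroFrame.
Variables (K : numFieldType) (V : lmodType K) (n : nat) (J : 'M[K]_n).
Hypothesis J_anti : forall i j, J i j = - J j i.
Local Notation symbol := (nat -> seq V -> K).
Implicit Types (a b w : symbol).

(** With all contraction vectors zero, a contraction applies the antisymmetric [J] to a quantity
    independent of i and j, hence vanishes; the product is then commutative. *)
Lemma ad_zero_frame (hb : K) w a l ys : ad J (fun=> 0) hb w a l ys = 0.
Proof.
have bidiffS r h zs : bidiff J (fun=> 0) r.+1 h zs = 0.
  rewrite -[RHS](bidiff0 J (fun=> 0) 0 zs); apply: eq_splits => us vs _ /=.
  apply: sumr_antisym => i j; by rewrite J_anti mulNr.
suff -> : ad J (fun=> 0) hb w a l ys =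
    (moyal J (fun=> 0) (hb / 2) a w l.+1 ys -
     moyal J (fun=> 0) (hb / 2) a w l.+1 ys) / hb.
  by rewrite subrr mul0r.
rewrite /ad (moyal_swap J_anti _ _ w); congr ((_ - _) / _).
have pow r h zs : (- (hb / 2)) ^+ r / r`!%:R * bidiff J (fun=> 0) r h zs =
    (hb / 2) ^+ r / r`!%:R * bidiff J (fun=> 0) r h zs.
  by case: r => [|r]; rewrite ?bidiffS ?mulr0.
by apply: eq_bigr => r _; apply: eq_bigr => p _; exact: pow.
Qed.

Lemma expad_zero_frame (hb : K) w a l ys : expad J (fun=> 0) hb w a l ys = a l ys.
Proof.
rewrite /expad big_ord_recl fact0 invr1 mul1r big1 ?addr0 // => k _.
by rewrite /= ad_zero_frame mulr0.
Qed.

End ZeroFrame.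

Section Frames.
Variables (K : numFieldType) (V : lmodType K) (n : nat) (J : 'M[K]_n).
Local Notation symbol := (nat -> seq V -> K).
Implicit Types (a b w : symbol) (h : seq V -> seq V -> K) (e : 'I_n -> V).

Definition bisymlin h := (forall zs, symlin (h^~ zs)) /\ (forall ys, symlin (h ys)).

Lemma contr_bisymlin e h : bisymlin h -> bisymlin (contr J e h).
Proof.
move=> [hl hr]; split=> xs; split=> [ys zs yz|t v w ys]; rewrite /contr /=.
- apply: eq_bigr => i _; apply: eq_bigr => j _; congr (_ * _).
  by apply: (hl _).1; rewrite perm_cons.
- rewrite mulr_sumr -big_split; apply: eq_bigr => i _ /=.
  rewrite mulr_sumr -big_split; apply: eq_bigr => j _ /=.
  have sw u : h (e i :: u :: ys) (e j :: xs) = h (u :: e i :: ys) (e j :: xs).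
    by apply: (hl _).1; apply/permP => p /=; rewrite addnCA.
  by rewrite !sw (hl _).2; ring.
- apply: eq_bigr => i _; apply: eq_bigr => j _; congr (_ * _).
  by apply: (hr _).1; rewrite perm_cons.
rewrite mulr_sumr -big_split; apply: eq_bigr => i _ /=.
rewrite mulr_sumr -big_split; apply: eq_bigr => j _ /=.
have sw u : h (e i :: xs) (e j :: u :: ys) = h (e i :: xs) (u :: e j :: ys).
  by apply: (hr _).1; apply/permP => p /=; rewrite addnCA.
by rewrite !sw (hr _).2; ring.
Qed.

(** The bivector with matrix [J] is the same in two bases related by a symplectic matrix. *)
Lemma contr_frame e e' (S : 'M[K]_n) h ys zs :
  J *m J = - (1%:M) -> S *m J *m S^T = J ->
  (forall i, e' i = \sum_k S i k *: e k) -> bisymlin h ->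
  contr J e' h ys zs = contr J e h ys zs.
Proof.
move=> JJ SJS e'E [hl hr].
(* The symplectic group is closed under transposition: -J S^T J is a right inverse of S, hence also
   a left one. *)
have {}SJS : S^T *m J *m S = J.
  have H : (- (J *m S^T *m J)) *m S = 1%:M.
    apply: mulmx1C; rewrite mulmxN !mulmxA SJS JJ.
    exact: (@opprK _ (1%:M : 'M[K]_n)).
  have := congr1 (mulmx J) H.
  rewrite mulmx1 mulNmx mulmxN !mulmxA JJ !mulNmx mul1mx => {2}<-.
  exact/esym/(@opprK 'M[K]_n).
transitivity (\sum_k \sum_l (S^T *m J *m S) k l * h (e k :: ys) (e l :: zs)).
  2: by rewrite SJS.
transitivity (\sum_i \sum_j \sum_k \sum_l
   S i k * J i j * S j l * h (e k :: ys) (e l :: zs)).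
  apply: eq_bigr => i _; apply: eq_bigr => j _; rewrite !e'E.
  rewrite (symlin_sum (u := h^~ _)) // mulr_sumr; apply: eq_bigr => k _.
  rewrite symlin_sum // mulrCA 2!mulr_sumr; apply: eq_bigr => l _; ring.
under eq_bigr do rewrite exchange_big.
rewrite exchange_big; apply: eq_bigr => k _ /=.
under eq_bigr do rewrite exchange_big.
rewrite exchange_big; apply: eq_bigr => l _ /=.
rewrite mxE mulr_suml exchange_big; apply: eq_bigr => j _ /=.
by rewrite mxE !mulr_suml; apply: eq_bigr => i _; rewrite mxE.
Qed.

(** Contraction preserves [bisymlin], so the frames can be exchanged in one contraction after the
    other. *)
Lemma moyal_frame e e' (k : K) a b l ys :
  (forall h ys zs, bisymlin h -> contr J e h ys zs = contr J e' h ys zs) ->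
  multilin a -> multilin b -> moyal J e k a b l ys = moyal J e' k a b l ys.
Proof.
move=> ee' Ha Hb; apply: eq_bigr => r _; apply: eq_bigr => p _; congr (_ * _).
apply: eq_splits => us vs _; set h := (fun _ => _).
have hs : bisymlin h.
  rewrite /h; split=> xs; split=> [ys1 zs1 yz|t v w ys1].
  - by rewrite ((Ha _).1 _ _ yz).
  - by rewrite (Ha _).2; ring.
  - by rewrite ((Hb _).1 _ _ yz).
  by rewrite (Hb _).2; ring.
clearbody h; elim: (r : nat) us vs => //= s IH us vs.
rewrite -ee'; last by elim: (s) => //= s' IH'; exact: contr_bisymlin.
by apply: eq_bigr => i _; apply: eq_bigr => j _; rewrite IH.
Qed.

End Frames.

Lemma moyal_map (K : numFieldType) (V W : lmodType K) n (J : 'M[K]_n)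
    (f : V -> W) (e : 'I_n -> V) (k : K) (a b : nat -> seq W -> K) l ys :
  moyal J e k (fun l ys => a l (map f ys)) (fun l ys => b l (map f ys)) l ys =
  moyal J (f \o e) k a b l (map f ys).
Proof.
apply: eq_bigr => r _; apply: eq_bigr => p _; congr (_ * _).
rewrite [RHS]splits_map; apply: eq_splits => us vs _.
set h := (fun us vs => _); set h' := (fun us vs => _).
have : forall us vs, h us vs = h' (map f us) (map f vs) by [].
move: h h' => h h' hh'; elim: (r : nat) us vs => //= s IH us vs.
by apply: eq_bigr => i _; apply: eq_bigr => j _; rewrite IH.
Qed.

(* Greedy enlargement of a row-free matrix of values of ev.                   *)
Lemma separating_unitmx (K : fieldType) (F : Type) n (ev : F -> 'rV[K]_n) :
  (forall c : 'cV[K]_n, (forall f, ev f *m c = 0) -> c = 0) ->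
  exists fs : 'I_n -> F, (\matrix_i ev (fs i)) \in unitmx.
Proof.
move=> sep.
suff H k : (k <= n)%N -> exists fs : 'I_k -> F, row_free (\matrix_i ev (fs i)).
  by have [fs Hfs] := H n (leqnn n); exists fs; rewrite -row_free_unit.
elim: k => [|k IH] kn.
  exists (fun i : 'I_0 => False_rect F (notF (ltn_ord i))).
  by rewrite /row_free flatmx0 mxrank0.
have [fs Hfs] := IH (ltnW kn); set M := \matrix_i _ in Hfs.
(* With fewer than [n] independent rows, some nonzero [v] is orthogonal to all of them. A value of
   [ev] not orthogonal to [v] exists by separation and is independent of these rows. *)
have : kermx M^T != 0.
  rewrite kermx_eq0 /row_free mxrank_tr (eqP Hfs).
  by rewrite neq_ltn kn.
move=> /rowV0Pn[v /sub_kermxP vM v0].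
have [f Hf] : exists f, ev f *m v^T != 0.
  apply: contrapT => /forallNP H; case/negP: v0.
  rewrite -trmx_eq0; apply/eqP/sep => f.
  by apply/eqP/negPn/negP; exact: H.
pose fs' (i : 'I_(1 + k)) := match fintype.split i with inl _ => f | inr j => fs j end.
exists fs'; rewrite -kermx_eq0; apply/rowV0P => u /sub_kermxP.
rewrite (_ : \matrix_i _ = col_mx (ev f) M); last first.
  apply/row_matrixP => i; rewrite rowK /fs'; case: (splitP i) => j ij.
    by rewrite (_ : i = lshift k j); [rewrite rowKu row_id|exact: val_inj].
  by rewrite (_ : i = rshift 1 j); [rewrite rowKd rowK|exact: val_inj].
set a := lsubmx (u : 'rV_(1 + k)); set b := rsubmx (u : 'rV_(1 + k)).
have -> : u = row_mx a b by rewrite hsubmxK.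
move=> E0; have E := etrans (esym (mul_row_col a b (ev f) M)) E0.
have Mv : M *m v^T = 0 by rewrite -[M]trmxK -trmx_mul vM trmx0.
have a0 : a = 0.
  have := congr1 (mulmx^~ v^T) E.
  rewrite mulmxDl -!mulmxA Mv mulmx0 addr0 mul0mx => /eqP.
  rewrite [ev f *m _]mx11_scalar mul_mx_scalar scaler_eq0 => /orP[|/eqP //].
  move=> /eqP fv; case/eqP: Hf; rewrite [LHS]mx11_scalar fv.
  by apply/matrixP => i j; rewrite !mxE mul0rn.
move: E; rewrite a0 mul0mx add0r => bM.
have -> : b = 0 by apply/eqP; rewrite -(mulmx_free_eq0 b Hfs) bM.
by apply/matrixP => i j; rewrite mxE; case: fintype.split => ?; rewrite !mxE.
Qed.

(** * Symplectic frames of the tangent spaces *)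

Section SymplecticFrames.
Variables (R : realType) (d : nat) (M : manifold R (d + d)).
Variable omega : symplectic_form M.
Local Notation F := (Cinfty M).
Local Notation J := (stdJ R d).
Implicit Types (x : M).

Lemma wmulE x (a b : weyl x) :
  wmul omega a b = moyal J (sframe omega x) ('i / 2) a b.
Proof. by []. Qed.

Lemma wadE x (a b : weyl x) : wad omega a b = ad J (sframe omega x) 'i a b.
Proof. by []. Qed.

Lemma wexpE x (a b : weyl x) : wexp omega a b = expad J (sframe omega x) 'i a b.
Proof. by []. Qed.

Lemma imag_neq0 : 'i != 0 :> R[i].
Proof. by rewrite eq_complex /= oner_eq0 andbF. Qed.

Lemma stdJ_sqr : J *m J = - (1%:M).
Proof.
rewrite /stdJ mulmx_block !mul0mx !mulmx0 !mulmx1 !add0r !addr0 mul1mx.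
by rewrite [in RHS](scalar_mx_block _ _ (1 : R[i])) opp_block_mx !oppr0.
Qed.

Lemma tangent_eq x (u v : tangent x) : (forall f, u f = v f) -> u = v.
Proof. by move=> uv; apply/val_inj/funext. Qed.

(** The zero family is the default value of [xget]. *)
Lemma sframeP x : is_sframe omega (sframe omega x) \/ sframe omega x = fun=> 0.
Proof.
have [[e He]|H] := pselect (exists e : 'I_(d + d) -> tangent x, is_sframe omega e).
  by left; exact: (xgetPex (fun=> 0) (ex_intro _ e He)).
by right; apply: xgetPN => e He; apply: H; exists e.
Qed.

Lemma form2_suml (b : form2 M) x m (t : 'I_m -> R[i]) (v : 'I_m -> tangent x) w :
  b x (\sum_i t i *: v i) w = \sum_i t i * b x (v i) w.
Proof.
elim: m t v => [|m IH] t v; last by rewrite !big_ord_recl form2_lin IH.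
rewrite !big_ord0 -[in LHS](addr0 0) -[X in X + _](scaler0 _ (-1)) form2_lin.
by rewrite mulN1r addNr.
Qed.

Lemma form2_sumr (b : form2 M) x m (t : 'I_m -> R[i]) (v : 'I_m -> tangent x) w :
  b x w (\sum_i t i *: v i) = \sum_i t i * b x w (v i).
Proof.
rewrite form2_anti form2_suml -sumrN; apply: eq_bigr => i _.
by rewrite (form2_anti _ w) mulrN.
Qed.

Lemma form2_0r (b : form2 M) x (w : tangent x) : b x w 0 = 0.
Proof.
by have := form2_sumr b (fun=> 0) (fun _ : 'I_0 => 0) w; rewrite !big_ord0.
Qed.

Section FrameCoordinates.
Variables (x : M) (e : 'I_(d + d) -> tangent x).
Hypothesis eP : is_sframe omega e.

(** If v = sum_k c_k e_k then omega(v, e_j) = sum_k c_k J_kj, and the inverse of [J] is [- J]. *)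
Definition fcoord i (v : tangent x) : R[i] := - \sum_j omega x v (e j) * J j i.

Lemma fcoordE v : v = \sum_i fcoord i v *: e i.
Proof.
have [c vE] := eP.2 v; rewrite {1}vE; apply: eq_bigr => i _; congr (_ *: _).
rewrite /fcoord; under eq_bigr do rewrite {1}vE form2_suml mulr_suml.
rewrite exchange_big -sumrN (bigD1 i) //= [X in _ + X]big1 ?addr0 => [|k ki].
  under eq_bigr do rewrite eP.1 -mulrA.
  have := congr1 (fun A : 'M[R[i]]_(d + d) => A i i) stdJ_sqr; rewrite !mxE eqxx => E.
  by rewrite -mulr_sumr E mulrN mulr1 opprK.
under eq_bigr do rewrite eP.1 -mulrA.
have := congr1 (fun A : 'M[R[i]]_(d + d) => A k i) stdJ_sqr.
by rewrite !mxE (negbTE ki) => E; rewrite -mulr_sumr E !oppr0 mulr0 oppr0.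
Qed.

End FrameCoordinates.

(** The matrix of coordinates of one symplectic frame in another is symplectic, by expanding
    omega(e'_i, e'_j). *)
Lemma contr_sframe x (e e' : 'I_(d + d) -> tangent x) h ys zs :
  is_sframe omega e -> is_sframe omega e' -> bisymlin h ->
  contr J e' h ys zs = contr J e h ys zs.
Proof.
move=> He He' hh; pose S := \matrix_(i, k) fcoord e k (e' i).
apply: (contr_frame (S := S)) => //; first exact: stdJ_sqr.
  apply/matrixP => i j; rewrite -He'.1 !mxE.
  rewrite [in RHS](fcoordE He (e' i)) form2_suml.
  under eq_bigr do rewrite mxE mulr_suml.
  rewrite exchange_big; apply: eq_bigr => k _ /=.
  rewrite (fcoordE He (e' j)) form2_sumr mulr_sumr; apply: eq_bigr => l _.
  by rewrite He.1 !mxE; ring.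
by move=> i; rewrite {1}(fcoordE He (e' i)); apply: eq_bigr => k _; rewrite mxE.
Qed.

Section Pull.
Variable g : diffeo M.
Hypothesis gS : symplecto omega g.

Lemma dpull_lin x (v : tangent (g x)) t f h :
  v (Cpull (dinv g) (t *: f + h)) = t * v (Cpull (dinv g) f) + v (Cpull (dinv g) h).
Proof. by rewrite -tangentZD; congr (tangent_val v _); exact: Cinfty_inj. Qed.

Lemma dpull_der x (v : tangent (g x)) f h : v (Cpull (dinv g) (f * h)) =
  v (Cpull (dinv g) f) * h x + f x * v (Cpull (dinv g) h).
Proof.
have -> : Cpull (dinv g) (f * h) = Cpull (dinv g) f * Cpull (dinv g) h.
  exact: Cinfty_inj.
by rewrite tangentM /= dmapK.
Qed.

(** Built directly at [x]: pushing forward along [dinv g] would land over [dinv g (g x)], which is a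
    different type. *)
Definition dpull x (v : tangent (g x)) : tangent x :=
  mk_tangent (dpull_lin v) (dpull_der v).

Lemma dpullK x (v : tangent (g x)) : dpush g (dpull v) = v.
Proof.
apply: tangent_eq => f /=; congr (tangent_val v _).
by apply: Cinfty_inj => y /=; rewrite dmap_invK.
Qed.

Lemma dpushK x (v : tangent x) : dpull (dpush g v) = v.
Proof.
apply: tangent_eq => f /=; congr (tangent_val v _).
by apply: Cinfty_inj => y /=; rewrite dmapK.
Qed.

Lemma dpush_sum x m (t : 'I_m -> R[i]) (v : 'I_m -> tangent x) :
  dpush g (\sum_i t i *: v i) = \sum_i t i *: dpush g (v i).
Proof.
elim: m t v => [|m IH] t v.
  by rewrite !big_ord0; exact: tangent_eq.
by rewrite !big_ord_recl -IH; exact: tangent_eq.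
Qed.

Lemma dpush_sframe x (e : 'I_(d + d) -> tangent x) :
  is_sframe omega e -> is_sframe omega (dpush g (x := x) \o e).
Proof.
move=> He; split=> [i j|v]; first by rewrite /= gS He.1.
by have [c E] := He.2 (dpull v); exists c; rewrite -dpush_sum -E dpullK.
Qed.

Lemma dpull_sframe x (e : 'I_(d + d) -> tangent (g x)) :
  is_sframe omega e -> is_sframe omega (@dpull x \o e).
Proof.
move=> He; split=> [i j|v]; first by rewrite /= -gS !dpullK He.1.
have [c E] := He.2 (dpush g v); exists c.
rewrite -[LHS]dpushK E -[RHS]dpushK; congr dpull.
by rewrite dpush_sum; apply: eq_bigr => i _; rewrite /= dpullK.
Qed.

Lemma sframe_push x : is_sframe omega (sframe omega x) <->
  is_sframe omega (sframe omega (g x)).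
Proof.
split=> H.
  exact: (xgetPex (fun=> 0) (ex_intro _ _ (dpush_sframe H))).
exact: (xgetPex (fun=> 0) (ex_intro _ _ (dpull_sframe H))).
Qed.

(** Pull-back replaces the chosen frame at [x] by its push-forward, a symplectic frame at [g x] that
    may differ from the chosen one; the product is the same for both. If neither point has a frame,
    both families are zero. *)
Lemma wmul_pull x (a b : weyl (g x)) l ys :
  weyl_multilinear a -> weyl_multilinear b ->
  wmul omega (fun l ys => a l (map (dpush g (x := x)) ys))
             (fun l ys => b l (map (dpush g (x := x)) ys)) l ys =
  wmul omega a b l (map (dpush g (x := x)) ys).
Proof.
move=> Ha Hb; rewrite !wmulE moyal_map.
have [H|H] := sframeP x.
  apply: moyal_frame => // h us vs hh; apply: contr_sframe => //.
    exact: (sframe_push x).1.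
  exact: dpush_sframe.
have [H'|->] := sframeP (g x).
  have {}H := (sframe_push x).2 H'.
  apply: moyal_frame => // h us vs hh; apply: contr_sframe => //.
  exact: dpush_sframe.
congr (moyal _ _ _ _ _ _ _); apply/funext => i; rewrite /= H.
exact: tangent_eq.
Qed.

End Pull.
End SymplecticFrames.

(** * Hamiltonian vector fields *)

Lemma sum_tangent (R : realType) n (M : manifold R n) (x : M) m
    (t : 'I_m -> R[i]) (v : 'I_m -> tangent x) f :
  (\sum_j t j *: v j : tangent x) f = \sum_j t j * v j f.
Proof.
elim: m t v => [|m IH] t v; first by rewrite !big_ord0.
by rewrite !big_ord_recl -IH.
Qed.

Section Hamiltonian.
Variables (R : realType) (d : nat) (M : manifold R (d + d)).
Variables (omega : symplectic_form M) (A : deformation_quantization omega).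
Local Notation F := (Cinfty M).
Local Notation J := (stdJ R d).
Implicit Types (f g h : F).

(* This is i {f, g}; its smoothness is inherited from the operator B_1.       *)
Definition hamiltonian f g : F := dq_B A 1 f g - dq_B A 1 g f.

Lemma hamiltonianE f g x : hamiltonian f g x = 'i * poisson omega f g x.
Proof. exact: dq_poisson. Qed.

Lemma hamiltonianZD f (a : R[i]) g h :
  hamiltonian f (a *: g + h) = a *: hamiltonian f g + hamiltonian f h.
Proof.
apply: Cinfty_inj => x.
rewrite -[RHS]/(a * hamiltonian f g x + hamiltonian f h x) !hamiltonianE.
rewrite mulrCA -mulrDr /poisson; congr (_ * _).
rewrite mulr_sumr -big_split; apply: eq_bigr => i _ /=.
rewrite mulr_sumr -big_split; apply: eq_bigr => j _ /=.
by rewrite tangentZD; ring.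
Qed.

Lemma hamiltonianM f g h :
  hamiltonian f (g * h) = hamiltonian f g * h + g * hamiltonian f h.
Proof.
apply: Cinfty_inj => x.
rewrite -[RHS]/(hamiltonian f g x * h x + g x * hamiltonian f h x) !hamiltonianE.
rewrite -mulrA [g x * _]mulrCA -mulrDr /poisson; congr (_ * _).
rewrite mulr_suml mulr_sumr -big_split; apply: eq_bigr => i _ /=.
rewrite mulr_suml mulr_sumr -big_split; apply: eq_bigr => j _ /=.
by rewrite tangentM; ring.
Qed.

(** These are globally defined smooth fields. Flatness is tested on global fields only, and the
    values of these span the tangent space at a point with a symplectic frame. *)
Definition hamiltonian_vf f : vfield M := mk_vfield (hamiltonianZD f) (hamiltonianM f).

Lemma vf_at_hamiltonian f x :
  vf_at x (hamiltonian_vf f) =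
  \sum_j ('i * \sum_i J i j * sframe omega x i f) *: sframe omega x j.
Proof.
apply: tangent_eq => g; rewrite -[LHS]/(hamiltonian f g x) hamiltonianE.
rewrite sum_tangent /poisson exchange_big mulr_sumr; apply: eq_bigr => j _.
rewrite -mulrA mulr_suml; congr (_ * _); apply: eq_bigr => i _.
by rewrite mulrA.
Qed.

End Hamiltonian.

(** * Functions with differentials dual to a symplectic frame *)

Section DualFunctions.
Variables (R : realType) (d : nat) (M : manifold R (d + d)).
Variables (omega : symplectic_form M) (x : M) (e : 'I_(d + d) -> tangent x).
Hypothesis eP : is_sframe omega e.
Local Notation F := (Cinfty M).

Lemma tangent_sum (v : tangent x) m (t : 'I_m -> R[i]) (f : 'I_m -> F) :
  v (\sum_i t i *: f i) = \sum_i t i * v (f i).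
Proof.
elim: m t f => [|m IH] t f; last by rewrite !big_ord_recl tangentZD IH.
rewrite !big_ord0 -[in LHS](addr0 0) -[X in X + _](scaler0 _ (-1)) tangentZD.
by rewrite mulN1r addNr.
Qed.

Lemma tangent1 (v : tangent x) : v 1 = 0.
Proof.
have := tangentM v 1 1; rewrite mulr1 -[(1 : F) x]/(1 : R[i]) mulr1 mul1r.
by move=> /eqP; rewrite -subr_eq0 opprD addrA subrr sub0r oppr_eq0 => /eqP.
Qed.

(** Functions separate tangent vectors and a symplectic frame is linearly independent, so finitely
    many functions give an invertible matrix of derivatives; its inverse supplies the
    coefficients. *)
Lemma dual_functions : exists phi : 'I_(d + d) -> F,
  forall i j, e j (phi i) = (i == j)%:R.
Proof.
pose ev f : 'rV[R[i]]_(d + d) := \row_j e j f.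
have [|fs fsU] := @separating_unitmx _ F _ ev.
  move=> c cf; apply/matrixP => i k; rewrite ord1 mxE.
  have : \sum_j c j ord0 *: e j = 0.
    apply: tangent_eq => f; rewrite sum_tangent.
    have /matrixP/(_ ord0 ord0) := cf f; rewrite !mxE => E.
    by rewrite -[RHS]E; apply: eq_bigr => j _; rewrite mxE mulrC.
  (* Independence of the frame: pairing the relation with each [e l] gives J c = 0, and [J] is
     invertible. *)
  move=> c0; have Jc : stdJ R d *m c = 0.
    apply/matrixP => l k'; rewrite ord1 !mxE.
    transitivity (omega x (e l) (\sum_j c j ord0 *: e j)).
      by rewrite form2_sumr; apply: eq_bigr => j _; rewrite eP.1 mulrC.
    by rewrite c0 form2_0r.
  have := congr1 (mulmx (stdJ R d)) Jc.
  rewrite mulmxA stdJ_sqr mulNmx mul1mx mulmx0 => /matrixP/(_ i ord0).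
  by rewrite !mxE => /eqP; rewrite oppr_eq0 => /eqP.
pose P := \matrix_i ev (fs i) : 'M[R[i]]_(d + d).
exists (fun i => \sum_k invmx P i k *: fs k) => i j; rewrite tangent_sum.
have /matrixP/(_ i j) := mulVmx fsU; rewrite !mxE => <-.
by apply: eq_bigr => k _; rewrite !mxE.
Qed.

End DualFunctions.

(** * Density of flat sections *)

Section FlatSections.
Variables (R : realType) (d : nat) (M : manifold R (d + d)).
Variables (omega : symplectic_form M) (A : deformation_quantization omega).
Variables (D : fedosov omega) (q : fseries M -> wsection M).
Hypothesis qP : kernel_iso A D q.
Local Notation F := (Cinfty M).
Local Notation J := (stdJ R d).
Local Notation e x := (sframe omega x).

Lemma flat_symbol0 f x : q f x 0 [::] = f 0%N x.
Proof.
have [_ _ _ _ [T [T0 _ TE]]] := qP.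
by rewrite TE big_ord1 subnn T0.
Qed.

Lemma flatP f X x l ys : D X (q f) x l ys = 0.
Proof. by have [_ H _ _ _] := qP; apply: (H (q f)).2; exists f. Qed.

Variables (x : M).
Hypothesis eP : is_sframe omega (e x).

(** The degree 0 component of D_X s = 0. There [A] enters only through its part omega(X, -), whose
    bracket with s is minus the first derivative of s along X. *)
Lemma flat_degree1_vf f X : q f x 0 [:: vf_at x X] = (X (f 0%N) : F) x.
Proof.
have := flatP f X 0 ([::] : seq (tangent x)).
rewrite fed_conE wadE ad_degree0; [|exact: stdJ_anti|exact: imag_neq0].
have := fed_D0E D X (q f) 0 [::] x; rewrite big_ord0 subr0 => /= ->.
have -> : wcoef (q f) 0 [::] = f 0%N by apply: Cinfty_inj => y; exact: flat_symbol0.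
set S := \sum_i _.
have -> : S = - q f x 0 [:: vf_at x X].
  rewrite (fcoordE eP (vf_at x X)).
  rewrite (symlin_sum _ _ _ (wval_multilinear (q f) x 0)).
  rewrite /S exchange_big -sumrN; apply: eq_bigr => j _ /=.
  rewrite /fcoord mulNr opprK mulr_suml; apply: eq_bigr => i _.
  by rewrite fed_A_deg1; ring.
by move=> /eqP; rewrite subr_eq0 => /eqP.
Qed.

Lemma tangent_hamiltonian (u : tangent x) : exists c (h : 'I_(d + d) -> F),
  u = \sum_i c i *: vf_at x (hamiltonian_vf A (h i)).
Proof.
have [phi phiE] := dual_functions eP.
have vfE i : vf_at x (hamiltonian_vf A (phi i)) = \sum_j ('i * J i j) *: e x j.
  rewrite vf_at_hamiltonian; apply: eq_bigr => j _; congr (_ * _ *: _).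
  rewrite (bigD1 i) //= big1 ?addr0 => [|k ki]; first by rewrite phiE eqxx mulr1.
  by rewrite phiE eq_sym (negbTE ki) mulr0.
(* The Hamiltonian field of [phi i] is sum_j i J_ij e_j at [x], and the inverse of the matrix i J is
   - J / i. *)
exists (fun i => - \sum_k fcoord omega (e x) k u * J k i / 'i), phi.
under eq_bigr do rewrite vfE scaler_sumr.
rewrite exchange_big /= {1}(fcoordE eP u); apply: eq_bigr => j _.
under eq_bigr do rewrite scalerA; rewrite -scaler_suml; congr (_ *: _).
transitivity (- \sum_i \sum_k fcoord omega (e x) k u * (J k i * J i j)).
  rewrite exchange_big (bigD1 j) //= [X in - (_ + X)]big1 ?addr0 => [|k kj].
    have := congr1 (fun B : 'M[R[i]]_(d + d) => B j j) (stdJ_sqr R d).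
    by rewrite !mxE eqxx => E; rewrite -mulr_sumr E mulrN mulr1 opprK.
  have := congr1 (fun B : 'M[R[i]]_(d + d) => B k j) (stdJ_sqr R d).
  by rewrite !mxE (negbTE kj) => E; rewrite -mulr_sumr E oppr0 mulr0.
rewrite -sumrN; apply: eq_bigr => i _; rewrite mulNr mulr_suml; congr (- _).
apply: eq_bigr => k _; have := imag_neq0 R => i0.
by rewrite -!mulrA [_^-1 * _]mulrA mulVf // mul1r.
Qed.

Lemma flat_degree1 f (u : tangent x) : q f x 0 [:: u] = u (f 0%N).
Proof.
have [c [h uE]] := tangent_hamiltonian u.
rewrite uE sum_tangent (symlin_sum _ _ _ (wval_multilinear (q f) x 0)).
by apply: eq_bigr => i _; rewrite flat_degree1_vf.
Qed.

Definition flat_at (a : weyl x) := exists f, q f x = a.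

Lemma flat_at_lin t a b : flat_at a -> flat_at b ->
  flat_at (fun l ys => hscale t a l ys + b l ys).
Proof.
move=> [f <-] [g <-]; exists (fseries_add (fseries_scale t f) g).
have [_ _ lin _ _] := qP.
by apply/funext => l; apply/funext => ys; rewrite lin.
Qed.

Lemma hscale_delta (V : lmodType R[i]) h (k : R[i]) (a : nat -> seq V -> R[i]) l ys :
  hscale (fun i => (i == h)%:R * k) a l ys = if (h <= l)%N then k * a (l - h)%N ys else 0.
Proof.
rewrite /hscale; case: leqP => hl; last first.
  rewrite big1 // => i _; case: eqP => [ih|_]; last by rewrite !mul0r.
  by move: (ltn_ord i); rewrite ih ltnS leqNgt hl.
rewrite (bigD1 (Ordinal (hl : (h < l.+1)%N))) //= eqxx mul1r big1 ?addr0 // => i.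
by rewrite -val_eqE /= => /negbTE ->; rewrite !mul0r.
Qed.

Lemma flat_at_linear k a b : flat_at a -> flat_at b ->
  flat_at (fun l ys => k * a l ys + b l ys).
Proof.
move=> Ha Hb; rewrite (_ : (fun l ys => _) = fun l ys =>
  hscale (fun i => (i == 0%N)%:R * k) a l ys + b l ys); first exact: flat_at_lin.
by apply/funext => l; apply/funext => ys; rewrite hscale_delta subn0.
Qed.

Lemma flat_at0 : flat_at (fun _ _ => 0).
Proof.
pose a := q (fun=> 0) x; have Ha : flat_at a by exists (fun=> 0).
have := flat_at_linear (-1) Ha Ha; congr flat_at.
by apply/funext => l; apply/funext => ys; rewrite mulN1r addNr.
Qed.

Lemma flat_at_sum m (B : 'I_m -> weyl x) : (forall i, flat_at (B i)) ->
  flat_at (fun l ys => \sum_i B i l ys).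
Proof.
elim: m B => [|m IH] B HB.
  rewrite (_ : (fun l ys => _) = fun _ _ => 0); first exact: flat_at0.
  by apply/funext => l; apply/funext => ys; rewrite big_ord0.
have := flat_at_linear 1 (HB ord0) (IH _ (fun i => HB (lift ord0 i))); congr flat_at.
by apply/funext => l; apply/funext => ys; rewrite big_ord_recl mul1r.
Qed.

Lemma flat_at_mul a b : flat_at a -> flat_at b -> flat_at (wmul omega a b).
Proof.
move=> [f <-] [g <-]; exists (star A f g); have [_ _ _ mul _] := qP.
by apply/funext => l; apply/funext => ys; rewrite mul.
Qed.

Lemma flat_at_unit : exists2 a, flat_at a & a 0%N [::] = 1.
(* The witness is the series 1 + hbar + hbar^2 + ...; only its leading coefficient matters. *)
Proof. by exists (q (fun=> 1) x); [exists (fun=> 1)|rewrite flat_symbol0]. Qed.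

Lemma flat_at_generator i : exists a, [/\ flat_at a, a 0%N [::] = 0 &
  forall v, a 0%N [:: v] = fcoord omega (e x) i v].
Proof.
have [phi phiE] := dual_functions eP.
(* Subtracting the value at [x] removes the degree 0 part and keeps the differential. *)
pose f : F := (- phi i x) *: (1 : F) + phi i.
exists (q (fun=> f) x); split; first by exists (fun=> f).
  rewrite flat_symbol0 -[LHS]/(- phi i x * 1 + phi i x).
  by rewrite mulr1 addNr.
move=> v; rewrite flat_degree1 tangentZD tangent1 mulr0 add0r.
rewrite {1}(fcoordE eP v) sum_tangent (bigD1 i) //= big1 ?addr0 => [|k ki].
  by rewrite phiE eqxx mulr1.
by rewrite phiE eq_sym (negbTE ki) mulr0.
Qed.

(* By Euler's identity, the part of positive polynomial degree of a symbol of *)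
(* degree m + 1 is a sum of products of generators with symbols of degree m.  *)
Lemma flat_at_leading m (a : weyl x) : weyl_multilinear a -> weyl_ge m a ->
  exists2 b, flat_at b &
    forall l ys, (l.*2 + size ys <= m)%N -> b l ys = a l ys.
Proof.
have [c0 Hc0 c01] := flat_at_unit.
elim: m a => [|m IH] a Ha age.
  (* In degree 0 the only component is the constant one. *)
  exists (fun l ys => a 0%N [::] * c0 l ys + 0).
    exact: flat_at_linear Hc0 flat_at0.
  case=> [|l] [|y ys] //= _; by rewrite c01 mulr1 addr0.
pose b k : weyl x := fun l ys => (size ys).+1%:R^-1 * a l (e x k :: ys).
have Hb k : weyl_multilinear (b k).
  move=> l; have [sa la] := Ha l; split=> [ys zs yz|t u v ys].
    by rewrite /b (perm_size yz); congr (_ * _); apply: sa; rewrite perm_cons.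
  have sw w : a l (e x k :: w :: ys) = a l (w :: e x k :: ys).
    by apply: sa; apply/permP => p /=; rewrite addnCA.
  by rewrite /b !sw la /=; ring.
have bge k : weyl_ge m (b k).
  by move=> l ys H; rewrite /b age ?mulr0 //= addnS ltnS.
have /choice[B HB] k : exists B, flat_at B /\
    forall l ys, (l.*2 + size ys <= m)%N -> B l ys = b k l ys.
  by have [B ? ?] := IH _ (Hb k) (bge k); exists B.
have /choice[y Hy] := flat_at_generator.
(* Euler's identity misses the component without arguments, here the multiple of hbar^h, where 2 h =
   m + 1. For odd m + 1 one has 2 h = m, and [a h [::]] is zero because [a] starts in degree m +
   1. *)
pose h := m.+1./2; have hm : (h.*2 <= m.+1)%N by rewrite -geq_half_double.
pose t i : R[i] := (i == h)%:R * a h [::].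
exists (fun l ys => hscale t c0 l ys + \sum_k wmul omega (y k) (B k) l ys).
  apply: flat_at_lin => //; apply: flat_at_sum => k.
  by apply: flat_at_mul; [case: (Hy k)|case: (HB k)].
move=> l ys lm.
rewrite (eq_bigr (fun k =>
  moyal J (e x) ('i / 2) (cov (fcoord omega (e x) k)) (b k) l ys)).
  rewrite (@euler_moyal R[i] (tangent x) (d + d) J (@stdJ_anti R d) (e x) ('i / 2)
    (fcoord omega (e x)) a) //; last by move=> v; exact: fcoordE.
  rewrite hscale_delta; case: ys lm => [|z zs] lm /=.
    rewrite addr0; rewrite addn0 in lm.
    have lh : (l <= h)%N by rewrite geq_half_double.
    case: leqP => hl; last by rewrite age // addn0 (leq_trans _ hm) // ltn_double.
    have -> : l = h by apply/eqP; rewrite eqn_leq lh.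
    by rewrite subnn c01 mulr1.
  case: leqP => hl; last by rewrite add0r.
  rewrite [a h _]age ?mul0r ?add0r // addn0.
  by apply: leq_trans lm; rewrite addnS ltnS (leq_trans _ (leq_addr _ _)) // leq_double.
(* Up to degree m + 1 the unknown higher terms drop out: [y k] starts with its covector in degree 1
   and [B k] agrees with [b k], which starts in degree m. *)
move=> k _; apply: eq_moyal => p us r vs E.
have [_ y0 y1] := Hy k; have [_ HBk] := HB k.
have [low|high] := leqP (p.*2 + size us) 1; last first.
  have Er : (r.*2 + size vs < m)%N.
    by rewrite -ltnS -add2n (leq_trans _ lm) // -E leq_add2r.
  by rewrite HBk ?bge ?mulr0 // ltnW.
case: p us low E => [|p] [|u [|u' us]] //= _ E; first by rewrite y0 !mul0r.
by rewrite y1 HBk // -ltnS; apply: leq_trans lm; rewrite -E add1n.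
Qed.

End FlatSections.

(* As the values of flat sections at x are dense, the product of W_x inherits *)
(* its properties from the star product.                                      *)
Section Density.
Variables (R : realType) (d : nat) (M : manifold R (d + d)).
Variables (omega : symplectic_form M) (A : deformation_quantization omega).
Variables (D : fedosov omega) (q : fseries M -> wsection M).
Hypothesis qP : kernel_iso A D q.
Variables (x : M).
Hypothesis eP : is_sframe omega (sframe omega x).

(** Successive approximation: the error of lowest degree is the leading part of a symbol, hence is
    matched by a flat value. *)
Lemma flat_at_dense m (a : weyl x) : weyl_multilinear a ->
  exists f, forall l ys, (l.*2 + size ys < m)%N -> q f x l ys = a l ys.
Proof.
move=> Ha; elim: m => [|m [f Hf]]; first by exists (fun=> 0).
pose r : weyl x := fun l ys => (-1) * q f x l ys + a l ys.
have rE l ys : r l ys = a l ys - q f x l ys by rewrite /r mulN1r addrC.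
have Hr : weyl_multilinear r by apply: multilin_lin => //; exact: wval_multilinear.
have rge : weyl_ge m r by move=> l ys H; rewrite rE Hf // subrr.
have [b Hb bE] := flat_at_leading qP eP Hr rge.
have Hf' : flat_at q (q f x : weyl x) by exists f.
have [g gE] := flat_at_linear qP 1 Hf' Hb; exists g => l ys lm.
by rewrite gE (bE _ _ lm) rE mul1r addrC subrK.
Qed.

(** Up to any given degree the product agrees with the value of the flat section of a star product,
    and sections are multilinear by definition. *)
Lemma wmul_multilinear (a b : weyl x) :
  weyl_multilinear a -> weyl_multilinear b -> weyl_multilinear (wmul omega a b).
Proof.
move=> Ha Hb; have approx m : exists f, forall l ys, (l.*2 + size ys < m)%N ->
    wmul omega a b l ys = q f x l ys.
  have [f fa] := flat_at_dense m Ha; have [g gb] := flat_at_dense m Hb.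
  exists (star A f g) => l ys H; have [_ _ _ -> _] := qP.
  apply: eq_moyal => p us r vs E.
  by rewrite fa ?gb // (leq_ltn_trans _ H) // -E ?leq_addr ?leq_addl.
move=> l; split=> [ys zs yz|t u v ys].
  have [f H] := approx (l.*2 + size ys).+1.
  rewrite !H -?(perm_size yz) //; exact: (wval_multilinear (q f) x l).1.
have [f H] := approx (l.*2 + (size ys).+1).+1.
rewrite !H //; exact: (wval_multilinear (q f) x l).2.
Qed.

Lemma wmulA (a b c : weyl x) l ys :
  weyl_multilinear a -> weyl_multilinear b -> weyl_multilinear c ->
  wmul omega a (wmul omega b c) l ys = wmul omega (wmul omega a b) c l ys.
Proof.
move=> Ha Hb Hc; set m := (l.*2 + size ys).+1.
have [f fa] := flat_at_dense m Ha; have [g gb] := flat_at_dense m Hb.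
have [h hc] := flat_at_dense m Hc.
have [_ _ _ qM _] := qP.
transitivity (q (star A f (star A g h)) x l ys).
  rewrite qM; apply: eq_moyal => p us r vs E.
  have pm : (p.*2 + size us < m)%N by rewrite ltnS -E leq_addr.
  have rm : (r.*2 + size vs < m)%N by rewrite ltnS -E leq_addl.
  rewrite fa // qM; congr (_ * _); apply: eq_moyal => p' us' r' vs' E'.
  by rewrite gb ?hc // (leq_ltn_trans _ rm) // -E' ?leq_addr ?leq_addl.
have -> : star A f (star A g h) = star A (star A f g) h by exact: dq_assoc.
rewrite qM; apply: eq_moyal => p us r vs E.
have pm : (p.*2 + size us < m)%N by rewrite ltnS -E leq_addr.
have rm : (r.*2 + size vs < m)%N by rewrite ltnS -E leq_addl.
rewrite hc // qM; congr (_ * _); apply: eq_moyal => p' us' r' vs' E'.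
by rewrite fa ?gb // (leq_ltn_trans _ pm) // -E' ?leq_addr ?leq_addl.
Qed.

End Density.

(** * The group G_1 acting on a fibre *)

Section G1Fibre.
Variables (R : realType) (d : nat) (M : manifold R (d + d)).
Variables (omega : symplectic_form M) (A : deformation_quantization omega).
Variables (D : fedosov omega) (q : fseries M -> wsection M).
Hypothesis qP : kernel_iso A D q.

Lemma wexp_wmul (x : M) (w a b : weyl x) l ys :
  weyl_multilinear w -> weyl_ge 3 w -> weyl_multilinear a -> weyl_multilinear b ->
  wexp omega w (wmul omega a b) l ys = wmul omega (wexp omega w a) (wexp omega w b) l ys.
Proof.
move=> Hw w3 Ha Hb; have [eP|e0] := sframeP omega x.
  apply: (expad_prod (@stdJ_anti R d) (imag_neq0 R)) => //.
    by move=> a' b'; exact: (wmul_multilinear qP eP).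
  by move=> a' b' c' l' ys'; exact: (wmulA qP eP).
have wexp_id c l' zs : wexp omega w c l' zs = c l' zs.
  by rewrite wexpE e0 expad_zero_frame //; exact: stdJ_anti.
by rewrite wexp_id; apply: eq_moyal => p us r vs _; rewrite !wexp_id.
Qed.

(** Continuity for the degree filtration, by applying [expad_ge] to the difference. *)
Lemma wexp_eq_upto (x : M) (w a b : weyl x) m : weyl_ge 3 w ->
  (forall l ys, (l.*2 + size ys < m)%N -> a l ys = b l ys) ->
  forall l ys, (l.*2 + size ys < m)%N -> wexp omega w a l ys = wexp omega w b l ys.
Proof.
move=> w3 ab l ys H.
have := expad_ge (stdJ R d) (sframe omega x) 'i w3
  (a := fun l ys => (-1) * b l ys + a l ys) (s := m).
move=> /(_ _ _ _ H); rewrite expad_lin; last exact: stdJ_anti.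
rewrite mulN1r addrC => E; apply/eqP; rewrite -subr_eq0; apply/eqP; apply: E.
by move=> l' ys' H'; rewrite ab // mulN1r addNr.
Qed.

Lemma wexp_lin (x : M) (w a b : weyl x) t l ys :
  wexp omega w (fun l ys => t * a l ys + b l ys) l ys =
  t * wexp omega w a l ys + wexp omega w b l ys.
Proof. by rewrite wexpE expad_lin //; exact: stdJ_anti. Qed.

Lemma wexp_hscale (x : M) (w a : weyl x) t l ys : weyl_ge 3 w ->
  wexp omega w (hscale t a) l ys = hscale t (wexp omega w a) l ys.
Proof. by move=> w3; rewrite wexpE expad_hscale //; exact: stdJ_anti. Qed.

Lemma wexp0 (x : M) (w : weyl x) l ys : wexp omega w (fun _ _ => 0) l ys = 0.
Proof.
have iter0 k : iter k (wad omega w) (fun _ _ => 0) = fun _ _ => 0.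
  elim: k => //= k ->; apply/funext => l'; apply/funext => ys'.
  by rewrite wadE ad0 //; exact: stdJ_anti.
by rewrite /wexp big1 // => k _; rewrite iter0 mulr0.
Qed.

End G1Fibre.

(** * Equality and pull-back of sections of the Weyl bundle *)

Section WeylSections.
Variables (R : realType) (n : nat) (M : manifold R n).

Lemma wsection_eq (s t : wsection M) :
  (forall x l ys, s x l ys = t x l ys) -> s = t.
Proof.
case: s t => s sm ss [t tm ts] /= E.
have {}E : s = t.
  by apply: functional_extensionality_dep => x; do 2!apply/funext => ?.
by case: _ / E in tm ts *; congr WSection; exact: Prop_irrelevance.
Qed.

(** Tangent vectors at [x] and at [y] have different types; their underlying functionals on
    functions do not mention the point and can be compared. *)
Lemma wsection_cast (s : wsection M) x y l (ys : seq (tangent x)) (zs : seq (tangent y)) :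
  x = y -> map (@tangent_val _ _ _ _) ys = map (@tangent_val _ _ _ _) zs ->
  s x l ys = s y l zs.
Proof. by move=> xy; case: _ / xy zs => zs /(inj_map val_inj) ->. Qed.

Lemma wpull_comp (g h k : diffeo M) (s : wsection M) :
  (forall x, k x = g (h x)) -> wpull h (wpull g s) = wpull k s.
Proof.
move=> kE; apply: wsection_eq => x l ys /=; apply: wsection_cast => //.
rewrite -!map_comp; apply: eq_map => v; apply/funext => f /=.
by congr (tangent_val v _); apply: Cinfty_inj => y; rewrite /= kE.
Qed.

Lemma wpull_id (g : diffeo M) (s : wsection M) : (forall x, g x = x) -> wpull g s = s.
Proof.
move=> gE; apply: wsection_eq => x l ys /=; apply: wsection_cast => //.
rewrite -map_comp; apply: eq_map => v; apply/funext => f /=.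
by congr (tangent_val v _); apply: Cinfty_inj => y; rewrite /= gE.
Qed.

Lemma wpullK (g : diffeo M) : cancel (wpull g) (wpull (dinv g)).
Proof.
move=> s; apply: wsection_eq => x l ys /=; apply: wsection_cast; first exact: dmap_invK.
rewrite -!map_comp; apply: eq_map => v; apply/funext => f /=.
by congr (tangent_val v _); apply: Cinfty_inj => y; rewrite /= dmap_invK.
Qed.

Lemma wpullKV (g : diffeo M) : cancel (wpull (dinv g)) (wpull g).
Proof.
move=> s; apply: wsection_eq => x l ys /=; apply: wsection_cast; first exact: dmapK.
rewrite -!map_comp; apply: eq_map => v; apply/funext => f /=.
by congr (tangent_val v _); apply: Cinfty_inj => y; rewrite /= dmapK.
Qed.

End WeylSections.

(** * Lifts and cocycles *)

Section G1.
Variables (R : realType) (d : nat) (M : manifold R (d + d)).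
Variables (omega : symplectic_form M) (c : G1_section omega).

Lemma g1_eq_upto (s t : wsection M) x m :
  (forall l ys, (l.*2 + size ys < m)%N -> s x l ys = t x l ys) ->
  forall l ys, (l.*2 + size ys < m)%N -> c s x l ys = c t x l ys.
Proof.
have [w w3 cE] := g1_exp c; move=> st l ys H.
by rewrite !cE; apply: wexp_eq_upto H.
Qed.

Lemma g1_zero_frame (s : wsection M) x l ys :
  sframe omega x = (fun=> 0) -> c s x l ys = s x l ys.
Proof.
have [w w3 cE] := g1_exp c; move=> e0.
by rewrite cE wexpE e0 expad_zero_frame //; exact: stdJ_anti.
Qed.

Lemma g1_zero (s : wsection M) : (forall x l ys, s x l ys = 0) ->
  forall x l ys, c s x l ys = 0.
Proof.
have [w _ cE] := g1_exp c; move=> s0 x l ys.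
rewrite cE -[RHS](wexp0 omega (w x) l ys); congr (wexp _ _ _ _ _).
by apply/funext => l'; apply/funext.
Qed.

End G1.

Section Kernel.
Variables (R : realType) (d : nat) (M : manifold R (d + d)).
Variables (omega : symplectic_form M) (A : deformation_quantization omega).
Variables (D : fedosov omega) (q : fseries M -> wsection M).
Hypothesis qP : kernel_iso A D q.

Lemma kernel_isoD f g x l ys : q (fseries_add f g) x l ys = q f x l ys + q g x l ys.
Proof.
have [_ _ lin _ _] := qP.
(* Linearity of [q] is given for combinations a f + g only, so the scalar series 1 is inserted. *)
have {1}-> : f = fseries_scale (fun i => (i == 0%N)%:R * 1) f.
  apply/funext => m; rewrite /fseries_scale big_ord_recl big1 => [|i _].
    by rewrite addr0 mulr1 scale1r subn0.
  by rewrite mul0r scale0r.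
rewrite lin -[X in X + _]/(hscale (fun i => (i == 0%N)%:R * 1) (q f x) l ys).
by rewrite hscale_delta mul1r subn0.
Qed.

Lemma kernel_isoZ a f x l ys : q (fseries_scale a f) x l ys = hscale a (q f x) l ys.
Proof.
have [_ _ lin _ _] := qP.
have q0 : q (fun=> 0) x l ys = 0.
  have := kernel_isoD (fun=> 0) (fun=> 0) l ys.
  have -> : fseries_add (fun=> 0) (fun=> 0) = (fun=> 0) :> fseries M.
    by apply/funext => m; rewrite /fseries_add addr0.
  by move=> /eqP; rewrite -subr_eq0 opprD addrA subrr sub0r oppr_eq0 => /eqP.
rewrite (_ : fseries_scale a f = fseries_add (fseries_scale a f) (fun=> 0)).
  by rewrite lin q0 addr0.
by apply/funext => m; rewrite /fseries_add addr0.
Qed.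

(** By invariance, D_X (c g^* s) = c g^* (D_Y s) with Y the push-forward of X, and this vanishes for
    flat s. *)
Lemma con_invariant_kernel (g : diffeo M) (c : G1_section omega) f :
  con_invariant g c D -> exists f', q f' = c (wpull g (q f)).
Proof.
move=> inv; have [_ ker _ _ _] := qP; apply: (ker _).1 => X x l ys.
rewrite -inv g1K; apply: g1_zero => y p us.
rewrite /con_pull wpullK; exact: (flatP qP).
Qed.

(** Through the injective [q], the map [phi] becomes c g^*, and both factors respect sums, scalars
    and Weyl products. *)
Lemma lift_automorphism (g : diffeo M) (c : G1_section omega)
    (phi : fseries M -> fseries M) :
  symplecto omega g -> bijective phi ->
  (forall f, q (phi f) = c (wpull g (q f))) -> dq_automorphism A phi.
Proof.
move=> gS bij phiE; have [qI _ _ qM _] := qP; have [w w3 cE] := g1_exp c.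
have phiE' u x : q (phi u) x = wexp omega (w x) (wpull g (q u) x) :> weyl x.
  by apply/funext => p; apply/funext => us; rewrite phiE cE.
split=> // [f h|a f|f h]; apply: qI; apply: wsection_eq => x l ys.
- rewrite kernel_isoD !phiE' -[X in X + _]mul1r -wexp_lin.
  congr (wexp _ _ _ _ _); apply/funext => p; apply/funext => us /=.
  by rewrite kernel_isoD mul1r.
- rewrite kernel_isoZ !phiE' -wexp_hscale //; congr (wexp _ _ _ _ _).
  by apply/funext => p; apply/funext => us /=; rewrite kernel_isoZ.
rewrite qM !phiE' -(wexp_wmul qP) //; try exact: wval_multilinear.
congr (wexp _ _ _ _ _); apply/funext => p; apply/funext => us /=.
rewrite qM -wmul_pull //; exact: wval_multilinear.
Qed.

Section Action.
Variables (G : groupType) (rho : G -> diffeo M).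
Hypothesis rhoM : forall g h x, rho (g * h)%g x = rho g (rho h x).

Lemma wpull_rhoM g h s :
  wpull (dinv (rho g)) (wpull (rho (h * g)%g) s) = wpull (rho h) s.
Proof. by apply: wpull_comp => x; rewrite rhoM /= dmap_invK. Qed.

Lemma rho1 x : rho 1%g x = x.
Proof.
by apply: (can_inj (dmapK (rho 1%g))); rewrite -rhoM mulg1.
Qed.

Lemma cocycle1 (c : G -> G1_section omega) s : cocycle rho c -> c 1%g s = s.
Proof.
move=> /(_ 1%g 1%g s); rewrite /G1_act mulg1 wpull_id; last exact: rho1.
rewrite [wpull (dinv _) _]wpull_id ?g1_invK // => x.
by rewrite /= -{1}(rho1 x) dmapK.
Qed.

Hypothesis rho_symplecto : forall g, symplecto omega (rho g).

(** With k = h g and t = c_k^{-1} s the claim is c_g g^* c_h g_* t = c_k t. The hypothesis is the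
    case t = k^* (q f), and each component of both sides depends on finitely many degrees of t at
    one point. *)
Lemma cocycle_of_kernel (c : G -> G1_section omega) :
  (forall g h f, c g (wpull (rho g) (c h (wpull (rho h) (q f)))) =
     c (h * g)%g (wpull (rho (h * g)%g) (q f))) ->
  cocycle rho c.
Proof.
move=> coc g h s; set k := (h * g)%g; set t := g1_inv _ s.
rewrite -[RHS](g1_invK (c k)) -/t /G1_act; apply: wsection_eq => x l ys.
have [eP|neP] := pselect (is_sframe omega (sframe omega (rho k x))); last first.
  (* Symplectomorphisms preserve the existence of a frame, so [x] and [rho g x] have none either and
     all the operators act trivially there. *)
  have e0 y : (is_sframe omega (sframe omega y) ->
      is_sframe omega (sframe omega (rho k x))) -> sframe omega y = fun=> 0.
    by have [//|//] := sframeP omega y; move=> H /(_ H).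
  have ex : sframe omega x = fun=> 0 by apply: e0; apply: (sframe_push _ _).1.
  have egx : sframe omega (rho g x) = fun=> 0.
    by apply: e0 => /(sframe_push (rho_symplecto g) x).2; apply: (sframe_push _ _).1.
  rewrite !(g1_zero_frame _ _ _ _ ex) /= (g1_zero_frame _ _ _ _ egx).
  by rewrite -[in RHS](wpullKV (rho g) t).
pose m := (l.*2 + size ys).+1.
(* The approximation takes place at [rho k x], where the pull-back by [rho k] evaluates the section
   at [x]. *)
have [f fE] := flat_at_dense qP eP m
  (wval_multilinear (wpull (dinv (rho k)) t) (rho k x)).
pose t' := wpull (rho k) (q f).
have tt' p us : (p.*2 + size us < m)%N -> t x p us = t' x p us.
  by move=> H; rewrite -(wpullKV (rho k) t) /= fE ?size_map.
rewrite (@g1_eq_upto _ _ _ _ (c k) t t' x m) // /t' -coc.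
rewrite -(wpull_rhoM g h (q f)) -/k -/t'.
apply: (@g1_eq_upto _ _ _ _ _ _ _ x m) => // p us H /=.
apply: (@g1_eq_upto _ _ _ _ _ _ _ (rho g x) m); last by rewrite size_map.
move=> p' us' H' /=.
(* The arguments are generalized, keeping only their number, so that their base point can be
   rewritten to [x]. *)
move: (map _ us') (size_map (dpush (dinv (rho g)) (x := rho g x)) us').
move: H'; rewrite /= dmapK => H' vs E.
by apply: tt'; rewrite E.
Qed.

End Action.
End Kernel.

Theorem corollary4p1 (R : realType) (d : nat) (M : manifold R (d + d))
  (omega : symplectic_form M) (A : deformation_quantization omega)
  (theta : nat -> form2 M) (hA : char_class A theta)
  (G : groupType) (rho : G -> diffeo M)
  (rho_stab : forall g, symp_stabilizer omega theta (rho g))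
  (rhoM : forall g h x, rho (g * h)%g x = rho g (rho h x)) :
  (exists alpha, extended_action rho A alpha) <->
  (exists (D : fedosov omega) (q : fseries M -> wsection M)
      (c : G -> G1_section omega),
    [/\ kernel_iso A D q,
        forall g, con_invariant (rho g) (c g) D
      & cocycle rho c]).
Proof.
have rhoS g : symplecto omega (rho g) by case: (rho_stab g).
split=> [[alpha [_ alphaM [D [q [c [qP alphaE inv]]]]]]|[D [q [c [qP inv coc]]]]].
  exists D, q, c; split=> //; apply: (cocycle_of_kernel qP) => // g h f.
  by rewrite -!alphaE alphaM.
(* The operator c_g g^* preserves the kernel of the connection, so it can be read through [q] as a
   map of formal series. *)
have /choice[alpha0 alphaE0] (gf : G * fseries M) :
    exists f', q f' = c gf.1 (wpull (rho gf.1) (q gf.2)).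
  exact: (con_invariant_kernel qP).
pose alpha g f := alpha0 (g, f).
have alphaE g f : q (alpha g f) = c g (wpull (rho g) (q f)) by exact: alphaE0.
have [qI _ _ _ _] := qP.
have alphaM g h f : alpha g (alpha h f) = alpha (h * g)%g f.
  apply: qI; rewrite !alphaE.
  have := coc g h (c (h * g)%g (wpull (rho (h * g)%g) (q f))).
  by rewrite g1K /G1_act wpull_rhoM.
have alpha1 f : alpha 1%g f = f.
  by apply: qI; rewrite alphaE (cocycle1 rhoM) // wpull_id //; exact: rho1.
exists alpha; split=> //; last by exists D, q, c; split.
move=> g; apply: (lift_automorphism qP (rhoS g) _ (alphaE g)).
(* Bijectivity comes from the group law, since the cocycle condition forces [alpha 1] to be the
   identity. *)
by exists (alpha g^-1%g) => f; rewrite alphaM ?mulgV ?mulVg alpha1.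
Qed.
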